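(* Let $G$ be a finite nilpotent group (written additively, not necessarily abelian), and let $A,B$ be two non-empty subsets of $G$. If $A\neq B$, then $$|A\dotplus B|\geq\min\{p(G),\,|A|+|B|-2\},$$ where $A\dotplus B=\{a+b:\,a\in A,\ b\in B,\ a\neq b\}$.
   Context: The group operation of $G$ is written as $+$ even though $G$ need not be abelian. $p(G)$ denotes the least prime factor of $|G|$. The restricted sumset is $A\dotplus B=\{a+b:\,a\in A,\ b\in B,\ a\neq b\}$. *)

(* Defs.v *)
From mathcomp Require Import all_boot all_fingroup all_solvable.

Set Implicit Arguments.
Unset Strict Implicit.
Unset Printing Implicit Defensive.

Local Open Scope group_scope.

(* The paper writes the (possibly non-abelian) group law as +; here it is the
   multiplicative law of a finGroupType. *)
Definition restricted_sumset (gT : finGroupType) (A B : {set gT}) : {set gT} :=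
  [set a * b | a in A, b in B & a != b].

(* Main.v *)
Require Import Defs.
From mathcomp Require Import all_boot all_fingroup all_solvable.
From mathcomp Require Import all_algebra ring zify.

Set Implicit Arguments.
Unset Strict Implicit.
Unset Printing Implicit Defensive.

(* Induction along central extensions [f : G -> K] with kernel of prime order [q],
   for the sharper statement that the bound [|A| + |B| - 2] can only fail when
   [A = B] is a set of pairwise commuting elements.

   Inside a coset of the kernel one works in [F_q]: if all restricted sums lie in
   the zero set of [P], the polynomial [(x - y) P(x + y)] vanishes on [A x B], and
   pairing it with the Lagrange functionals of [A] and [B] shows that these have
   the same moments, hence [A = B].

   In general, split [A], [B] and the restricted sumset [C] into their fibres. The
   fibre of [C] over [x y] with [x != y] is estimated by Cauchy-Davenport, the
   fibre over [x x] by the case of a coset, and the number of nonempty fibres by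
   induction. Summing the fibres over [f(A) y], where [y] carries a largest fibre
   of [B], already gives the bound up to a defect that forces all fibres of [A] and
   [B] to have nearly the same size; the few remaining configurations are excluded
   one by one. *)

(** * Restricted sums in a finite field *)

(** In the field, a single coefficient of [(x - y) P(x + y)] settles sets of different sizes, but it
    is proportional to [|A| - |B|]; equal sizes are what makes the comparison of all moments
    necessary. The exception is genuine: a short progression of length [k >= 2] in [F_q] has only
    [2 k - 3] restricted sums with itself. Recording that exceptional sets commute is what lets the
    induction continue: when the images are exceptional, commutators of lifts lie in the kernel,
    hence are central. Noncommuting lifts are then excluded by translating by such a commutator or
    by counting along a commutator map. In the fibre count only the square [y y] of the chosen [y]
    can lose more than Cauchy-Davenport does, by at most 2, while a counterexample misses the bound
    by at least 1. The two numbers nearly cancel, which is why so few configurations survive.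
    Oddness of [p] enters through parity arguments and the field case; for [p <= 2] two restricted
    sums are enough, and they are exhibited directly. *)

Section RestrictedSumsField.
Import GRing.Theory.
Local Open Scope ring_scope.
Variable (F : finFieldType).
Implicit Types A B C : {set F}.

(** Weights of the top divided difference on [A]. For nonempty [A] the moment of index
    [i >= #|A| - 1] is the complete homogeneous symmetric polynomial of degree [i - (#|A| - 1)] in
    the elements of [A]. *)
Definition lagrange_wt A a : F := \prod_(c in A :\ a) (a - c)^-1.
Definition lagrange_moment A i : F := \sum_(a in A) lagrange_wt A a * a ^+ i.
Definition lagrange_poly A a : {poly F} := \prod_(c in A :\ a) ('X - c%:P).

Lemma lagrange_wt_neq0 A a : lagrange_wt A a != 0.
Proof.
apply/prodf_neq0 => c; rewrite !inE => /andP[ca _].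
by rewrite invr_eq0 subr_eq0 eq_sym.
Qed.

Lemma lagrange_polyV A a : (lagrange_poly A a).[a] = (lagrange_wt A a)^-1.
Proof.
rewrite /lagrange_poly horner_prod /lagrange_wt prodfV invrK.
by apply: eq_bigr => c _; rewrite hornerXsubC.
Qed.

Lemma lagrange_poly0 A a b : b \in A -> b != a -> (lagrange_poly A a).[b] = 0.
Proof.
move=> bA ba; rewrite horner_prod (bigD1 b) ?inE ?ba //=.
by rewrite hornerXsubC subrr mul0r.
Qed.

Lemma size_lagrange_poly A a : a \in A -> size (lagrange_poly A a) = #|A|.
Proof.
by move=> aA; rewrite /lagrange_poly -big_enum size_prod_XsubC -cardE (cardsD1 a A) aA.
Qed.

(** Lagrange interpolation recovers [q] from its values on [A]; every [lagrange_poly A a] is monic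
    of degree [#|A| - 1], so one compares coefficients in that degree. *)
Lemma lagrange_sum A (q : {poly F}) : (size q <= #|A|)%N ->
  \sum_(a in A) lagrange_wt A a * q.[a] = q`_#|A|.-1.
Proof.
move=> sq.
pose P : {poly F} := \sum_(a in A) (lagrange_wt A a * q.[a]) *: lagrange_poly A a.
have qP : q = P.
  apply/eqP; rewrite -subr_eq0; apply/eqP.
  apply: (@roots_geq_poly_eq0 _ _ (enum A)); last 2 first.
  - exact: enum_uniq.
  - rewrite -cardE; apply: leq_trans (size_polyD _ _) _.
    rewrite size_polyN geq_max sq /=; apply: leq_trans (size_sum _ _ _) _.
    apply/bigmax_leqP => a aA; apply: leq_trans (size_scale_leq _ _) _.
    by rewrite size_lagrange_poly.
  apply/allP => b; rewrite mem_enum => bA.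
  rewrite /root hornerD hornerN horner_sum (bigD1 b) //= big1 ?addr0.
    rewrite hornerZ lagrange_polyV mulrAC divff ?mul1r ?subrr //.
    exact: lagrange_wt_neq0.
  by move=> a /andP[aA ab]; rewrite hornerZ lagrange_poly0 ?mulr0 // eq_sym.
rewrite [in RHS]qP coef_sum; apply: eq_bigr => a aA; rewrite coefZ.
have : lead_coef (lagrange_poly A a) = 1.
  by apply/eqP/monic_prod => c _; apply: monicXsubC.
by rewrite lead_coefE size_lagrange_poly // => ->; rewrite mulr1.
Qed.

Lemma lagrange_moment_small A i : (i < #|A|.-1)%N -> lagrange_moment A i = 0.
Proof.
move=> iA; rewrite /lagrange_moment.
under eq_bigr do rewrite -hornerXn.
rewrite lagrange_sum ?coefXn ?size_polyXn; last by lia.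
by rewrite (_ : (_ == _) = false) //; lia.
Qed.

Lemma lagrange_moment_top A : (0 < #|A|)%N -> lagrange_moment A #|A|.-1 = 1.
Proof.
move=> A0; rewrite /lagrange_moment.
under eq_bigr do rewrite -hornerXn.
by rewrite lagrange_sum ?coefXn ?size_polyXn ?eqxx //; lia.
Qed.

Lemma lagrange_moment_horner A (q : {poly F}) k : (size q <= k)%N ->
  \sum_(a in A) lagrange_wt A a * q.[a] = \sum_(i < k) q`_i * lagrange_moment A i.
Proof.
move=> sq; under eq_bigr do rewrite (horner_coef_wide _ sq) mulr_sumr.
rewrite exchange_big /=; apply: eq_bigr => i _; rewrite /lagrange_moment mulr_sumr.
by apply: eq_bigr => a _; rewrite mulrCA.
Qed.

(** The test polynomial [h] has degree [2 * #|A| - 1], vanishes on [A], and on [B] can be nonzero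
    only at [b]. Equal functionals force its factor [g] to vanish at [b], that is, [b \in A]. *)
Lemma lagrange_moment_inj A B : #|A| = #|B| ->
  (forall i, (i < 2 * #|A|)%N -> lagrange_moment A i = lagrange_moment B i) -> A = B.
Proof.
move=> cAB mAB; apply/esym/eqP; rewrite eqEcard cAB leqnn andbT.
apply/subsetP => b bB.
pose g : {poly F} := \prod_(c in A) ('X - c%:P).
pose h := g * lagrange_poly B b.
have sh : (size h <= 2 * #|A|)%N.
  apply: leq_trans (size_polyMleq _ _) _.
  rewrite size_lagrange_poly // /g -big_enum size_prod_XsubC -cardE; lia.
have gA a : a \in A -> g.[a] = 0.
  by move=> aA; rewrite horner_prod (bigD1 a) //= hornerXsubC subrr mul0r.
have : \sum_(a in B) lagrange_wt B a * h.[a] = 0.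
  transitivity (\sum_(a in A) lagrange_wt A a * h.[a]).
    rewrite !(lagrange_moment_horner _ sh); apply: eq_bigr => i _.
    by rewrite mAB.
  by apply: big1 => a aA; rewrite hornerM gA // mul0r mulr0.
rewrite (bigD1 b) //= [X in _ + X]big1 ?addr0; last first.
  by move=> a /andP[aB ab]; rewrite hornerM lagrange_poly0 // !mulr0.
rewrite hornerM lagrange_polyV mulrCA divff ?lagrange_wt_neq0 // mulr1 => /eqP.
rewrite horner_prod prodf_seq_eq0 => /hasP[c _ /andP[cA]].
by rewrite hornerXsubC subr_eq0 => /eqP->.
Qed.

(* Coefficient of [x^l y^(k+1-l)] in [(x - y) (x + y)^k]. *)
Definition ballot k l : F :=
  (if l is l'.+1 then 'C(k, l')%:R else 0) - 'C(k, l)%:R.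

Lemma ballot_expand k (x y : F) :
  (x - y) * (x + y) ^+ k = \sum_(l < k.+2) ballot k l * x ^+ l * y ^+ (k.+1 - l).
Proof.
have E : (x + y) ^+ k = \sum_(l < k.+1) 'C(k, l)%:R * x ^+ l * y ^+ (k - l).
  by rewrite addrC exprDn; apply: eq_bigr => l _; rewrite -mulr_natl; ring.
rewrite mulrBl /ballot.
under [RHS]eq_bigr do rewrite !mulrBl.
rewrite big_split /= sumrN; congr (_ - _).
  rewrite E mulr_sumr [RHS]big_ord_recl /= !mul0r add0r; apply: eq_bigr => l _.
  by rewrite /bump /= add1n subSS exprS; ring.
rewrite E mulr_sumr [RHS]big_ord_recr /= bin_small // !mul0r addr0.
apply: eq_bigr => l _; rewrite subSn; last by rewrite -ltnS.
by rewrite exprS; ring.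
Qed.

(** Exchanging [x] and [y] negates [(x - y) (x + y)^k]. *)
Lemma ballot_sym k l : (l <= k.+1)%N -> ballot k (k.+1 - l) = - ballot k l.
Proof.
case: l => [|l] lk; rewrite /ballot.
  by rewrite subn0 (@bin_small k k.+1) // bin0 binn; ring.
rewrite subSS.
case: (ltngtP l k) => [ltlk||->]; [|lia|]; last first.
  by rewrite subnn bin0 binn (@bin_small k k.+1) //; ring.
rewrite -{1}(subnSK ltlk) !bin_sub // opprB //; lia.
Qed.

Definition vanishes_on_restricted_sums A B (P : {poly F}) :=
  forall a b, a \in A -> b \in B -> (a - b) * P.[a + b] = 0.

(** Since [x^i y^j (x - y) P(x + y)] vanishes on [A x B], applying the weights of [A] in [x] and
    those of [B] in [y] to its expansion gives 0. *)
Lemma moment_relation A B (P : {poly F}) N i j :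
  (size P <= N.+1)%N -> vanishes_on_restricted_sums A B P ->
  \sum_(k < N.+1) P`_k * \sum_(l < k.+2) ballot k l *
     (lagrange_moment A (l + i) * lagrange_moment B (k.+1 - l + j)) = 0.
Proof.
move=> sP van.
transitivity (\sum_(a in A) \sum_(b in B) lagrange_wt A a * lagrange_wt B b *
                 (a ^+ i * b ^+ j * ((a - b) * P.[a + b]))); last first.
  by apply: big1 => a aA; apply: big1 => b bB; rewrite van // !mulr0.
under [RHS]eq_bigr do under eq_bigr do
  rewrite (horner_coef_wide _ sP) !mulr_sumr.
under [RHS]eq_bigr do rewrite exchange_big /=.
rewrite [RHS]exchange_big /=; apply: eq_bigr => k _.
transitivity (\sum_(a in A) \sum_(b in B) \sum_(l < k.+2) P`_k * (ballot k l *
   ((lagrange_wt A a * a ^+ (l + i)) * (lagrange_wt B b * b ^+ (k.+1 - l + j))))); last first.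
  apply: eq_bigr => a _; apply: eq_bigr => b _.
  rewrite (_ : _ * _ = lagrange_wt A a * lagrange_wt B b * P`_k * a ^+ i * b ^+ j *
                       ((a - b) * (a + b) ^+ k)); last by ring.
  rewrite ballot_expand mulr_sumr; apply: eq_bigr => l _.
  by rewrite !exprD; ring.
under [RHS]eq_bigr do rewrite exchange_big /=.
rewrite [RHS]exchange_big /= mulr_sumr; apply: eq_bigr => l _.
rewrite /lagrange_moment big_distrlr /= !mulr_sumr; apply: eq_bigr => a _.
by rewrite !mulr_sumr.
Qed.

Section Characteristic.
Variable q : nat.
Hypothesis natF : forall n, (0 < n < q)%N -> n%:R != 0 :> F.

Lemma natr_fact_neq0 n : (n < q)%N -> n`!%:R != 0 :> F.
Proof.
elim: n => [|n IH] nq; first by rewrite oner_eq0.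
by rewrite factS natrM mulf_neq0 ?IH ?natF //; lia.
Qed.

Lemma natr_bin_neq0 n k : (k <= n < q)%N -> 'C(n, k)%:R != 0 :> F.
Proof.
move=> /andP[kn nq]; have := natr_fact_neq0 nq; rewrite -(bin_fact kn) natrM mulf_eq0.
by case/norP.
Qed.

Lemma ballot_mul n k :
  (k <= n)%N -> k.+1%:R * ballot n k.+1 = 'C(n, k)%:R * (k.+1%:R - (n - k)%:R).
Proof. by move=> kn; rewrite /ballot mulrBr -(natrM _ _ 'C(n, k.+1)) mul_bin_left natrM; ring. Qed.

(** The total degree [N + 1] equals [(#|A| - 1) + (#|B| - 1)] and lower moments vanish, so only one
    coefficient survives; up to nonzero factors it is [#|A| - #|B|]. *)
Lemma restricted_sums_unequal A B (P : {poly F}) N :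
  (0 < #|B|)%N -> (#|B| < #|A|)%N -> N.+3 = (#|A| + #|B|)%N -> (N < q)%N -> (#|A| <= q)%N ->
  size P = N.+1 -> P \is monic -> ~ vanishes_on_restricted_sums A B P.
Proof.
move=> B0 BA EN Nq Aq sP mP van.
have sP' : (size P <= N.+1)%N by rewrite sP.
have := moment_relation 0 0 sP' van.
have z k l : (k <= N)%N -> (l <= k.+1)%N -> (k, l) != (N, #|A|.-1) ->
  lagrange_moment A (l + 0) * lagrange_moment B (k.+1 - l + 0) = 0.
  rewrite !addn0 => kN lk ne.
  case: (ltnP l #|A|.-1) => h1; first by rewrite lagrange_moment_small ?mul0r.
  case: (ltnP (k.+1 - l) #|B|.-1) => h2; first by rewrite (@lagrange_moment_small B) ?mulr0.
  by case/negP: ne; apply/eqP; congr (_, _); lia.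
rewrite big_ord_recr /= big1 ?add0r; last first.
  move=> k _; rewrite big1 ?mulr0 // => l _; rewrite z ?mulr0 //.
  - by have := ltn_ord k; lia.
  - by have := ltn_ord l; lia.
  - by apply/eqP => -[]; have := ltn_ord k; lia.
have lA : (#|A|.-1 < N.+2)%N by lia.
rewrite (bigD1 (Ordinal lA)) //= big1 ?addr0; last first.
  move=> l; rewrite -val_eqE /= => ne; rewrite z ?mulr0 //.
  - by have := ltn_ord l; lia.
  - by apply/eqP => -[]; lia.
rewrite !addn0 (_ : (N.+1 - #|A|.-1)%N = #|B|.-1); last by lia.
rewrite !lagrange_moment_top //; last by lia.
have -> : P`_N = 1 by move/monicP: mP; rewrite lead_coefE sP.
rewrite !mulr1 mul1r => /(congr1 ( *%R #|A|.-1%:R)); rewrite mulr0.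
have -> : #|A|.-1 = #|A|.-2.+1 by lia.
rewrite ballot_mul; last by lia.
rewrite -natrB; last by lia.
by apply/eqP/mulf_neq0; [apply: natr_bin_neq0|apply: natF]; lia.
Qed.

(** Add the relation for [(i, j)] to the one for [(j, i)] read with [x] and [y] exchanged: by
    antisymmetry of [ballot], terms in which both moments agree cancel. Only the two terms pairing
    index [r] with index [r + (i + j)] remain. *)
Lemma moment_exchange A B (P : {poly F}) r i j :
  (0 < r)%N -> #|A| = r.+1 -> #|B| = r.+1 -> size P = (2 * r)%N -> P \is monic ->
  vanishes_on_restricted_sums A B P -> (i <= r)%N -> (j <= r)%N -> (0 < i + j)%N ->
  (forall s, (s < r + (i + j))%N -> lagrange_moment A s = lagrange_moment B s) ->
  (ballot (2 * r).-1 (r + i) + ballot (2 * r).-1 (r + j)) *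
  (lagrange_moment A (r + (i + j)) - lagrange_moment B (r + (i + j))) = 0.
Proof.
move=> r0 cA cB sP mP van ir jr ij0 mAB.
set N := (2 * r).-1; have EN : (N.+1 = 2 * r)%N by rewrite /N; lia.
have sP' : (size P <= N.+1)%N by rewrite sP EN.
set al := lagrange_moment A; set be := lagrange_moment B.
have al0 s : (s < r)%N -> al s = 0 by move=> sr; apply: lagrange_moment_small; rewrite cA.
have be0 s : (s < r)%N -> be s = 0 by move=> sr; apply: lagrange_moment_small; rewrite cB.
have al1 : al r = 1 by have := @lagrange_moment_top A; rewrite cA; apply.
have be1 : be r = 1 by have := @lagrange_moment_top B; rewrite cB; apply.
pose T (k l : nat) := ballot k l *
  (al (l + i)%N * be (k.+1 - l + j)%N - be (l + i)%N * al (k.+1 - l + j)%N).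
have ET : \sum_(k < N.+1) P`_k * \sum_(l < k.+2) T k l = 0.
  have e1 := moment_relation i j sP' van; have e2 := moment_relation j i sP' van.
  have := f_equal2 +%R e1 e2; rewrite addr0 => e3; apply: etrans e3.
  rewrite -big_split /=; apply: eq_bigr => k _.
  rewrite -mulrDr; congr (_ * _).
  rewrite [X in _ + X](reindex_inj rev_ord_inj) -big_split /=.
  apply: eq_bigr => l _; have lk : (l <= k.+1)%N by have := ltn_ord l; lia.
  rewrite (_ : (k.+2 - l.+1)%N = (k.+1 - l)%N); last by lia.
  rewrite ballot_sym // (_ : (k.+1 - (k.+1 - l))%N = l); last by lia.
  by rewrite /T /al /be; ring.
have T0 k l : (k <= N)%N -> (l <= k.+1)%N ->
    (k, l) != (N, r + j)%N -> (k, l) != (N, r - i)%N -> T k l = 0.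
  move=> kN lk ne1 ne2; rewrite /T.
  case: (ltnP (l + i) r) => h1; first by rewrite (al0 _ h1) (be0 _ h1) !mul0r subrr mulr0.
  case: (ltnP (k.+1 - l + j) r) => h2; first by rewrite (al0 _ h2) (be0 _ h2) !mulr0 subrr mulr0.
  have h3 : (l + i < r + (i + j))%N.
    case: ltnP => // h; case/negP: ne1; apply/eqP; congr (_, _); lia.
  have h4 : (k.+1 - l + j < r + (i + j))%N.
    case: ltnP => // h; case/negP: ne2; apply/eqP; congr (_, _); lia.
  by rewrite /al /be !mAB // subrr mulr0.
move: ET; rewrite big_ord_recr /= big1 ?add0r; last first.
  move=> k _; rewrite big1 ?mulr0 // => l _.
  have kN := ltn_ord k; have lk := ltn_ord l.
  by apply: T0; rewrite ?xpair_eqE; lia.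
have -> : P`_N = 1 by move/monicP: mP; rewrite lead_coefE sP.
have l1 : (r + j < N.+2)%N by lia.
have l2 : (r - i < N.+2)%N by lia.
rewrite mul1r (bigD1 (Ordinal l1)) //= (bigD1 (Ordinal l2)) /=; last first.
  by rewrite -val_eqE /=; lia.
rewrite big1 ?addr0; last first.
  move=> l; rewrite -!val_eqE /= => /andP[n1 n2]; have lk := ltn_ord l.
  by apply: T0; rewrite ?xpair_eqE; lia.
rewrite /T (_ : (r - i)%N = (N.+1 - (r + i))%N); last by lia.
rewrite ballot_sym; last by lia.
rewrite (_ : (N.+1 - (r + j) + j)%N = r); last by lia.
rewrite (_ : (N.+1 - (r + i) + i)%N = r); last by lia.
rewrite (_ : (N.+1 - (N.+1 - (r + i)) + j)%N = (r + (i + j))%N); last by lia.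
rewrite (_ : (r + j + i)%N = (r + (i + j))%N); last by lia.
by rewrite al1 be1 => <-; ring.
Qed.

(** The exchanges [(0, K + 1)] give equal moments up to index [2 r], because the middle coefficient
    is 0 and those beyond it are not. Index [2 r + 1], the last one [lagrange_moment_inj] asks for,
    is out of their reach and is treated through all pairs with [i + j = r + 1]. *)
Lemma restricted_sums_equal A B (P : {poly F}) r :
  odd q -> (0 < r)%N -> ((2 * r).-1 < q)%N -> #|A| = r.+1 -> #|B| = r.+1 ->
  size P = (2 * r)%N -> P \is monic -> vanishes_on_restricted_sums A B P -> A = B.
Proof.
move=> oq r0 rq cA cB sP mP van.
have ex := moment_exchange r0 cA cB sP mP van.
have nz2 : 2%:R != 0 :> F by apply: natF; move: rq oq; case: (q) => [|[|[|]]] //=; lia.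
have EN : ((2 * r).-1.+1 = 2 * r)%N by lia.
have bal k : (0 < k <= r)%N -> (r + k)%:R * ballot (2 * r).-1 (r + k) =
   'C((2 * r).-1, (r + k).-1)%:R * (2 * k)%:R.
  move=> kr; have -> : (r + k)%N = (r + k).-1.+1 by lia.
  rewrite ballot_mul; last by lia.
  by rewrite -natrB; [congr (_ * _%:R); lia|lia].
have bal0 k : (0 < k <= r)%N -> ballot (2 * r).-1 (r + k) != 0.
  move=> kr; apply/eqP => b0; have := bal k kr; rewrite b0 mulr0 => /esym/eqP.
  apply/negP/mulf_neq0; first by apply: natr_bin_neq0; lia.
  by rewrite natrM mulf_neq0 // natF //; lia.
have low K : (K <= r)%N -> forall s, (s <= r + K)%N ->
    lagrange_moment A s = lagrange_moment B s.
  elim: K => [|K IH] Kr s sK.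
    move: sK; rewrite addn0 leq_eqVlt => /orP[/eqP->|sr].
      have := @lagrange_moment_top A; have := @lagrange_moment_top B.
      by rewrite cA cB /= => -> // ->.
    by rewrite !lagrange_moment_small ?cA ?cB.
  move: sK; rewrite leq_eqVlt => /orP[/eqP->|sr]; last by apply: IH; lia.
  have := ex 0%N K.+1; rewrite addn0 add0n => /(_ isT Kr isT).
  have z : ballot (2 * r).-1 r = 0.
    have := @ballot_sym (2 * r).-1 r; rewrite EN (_ : (2 * r - r)%N = r); last by lia.
    move=> /(_ ltac:(lia)) /eqP; rewrite -subr_eq0 opprK -mulr2n -mulr_natl mulf_eq0.
    by rewrite (negPf nz2) => /eqP.
  rewrite z add0r => h; apply/eqP; rewrite -subr_eq0.
  have /eqP := h ltac:(by move=> t tK; apply: IH; lia).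
  by rewrite mulf_eq0 (negPf (bal0 _ _)) //; lia.
apply: lagrange_moment_inj; first by rewrite cA.
move=> s; rewrite cA => sr; case: (leqP s (r + r)) => sr'; first exact: (low r).
have -> : s = (r + r.+1)%N by lia.
apply/eqP; rewrite -subr_eq0; apply/negPn/negP => ne.
have key i j : (i <= r)%N -> (j <= r)%N -> (i + j)%N = r.+1 ->
   ballot (2 * r).-1 (r + i) + ballot (2 * r).-1 (r + j) = 0.
  move=> ir jr ij; have := ex i j ir jr; rewrite ij => /(_ isT) h.
  have /eqP := h ltac:(by move=> t tr; apply: (low r) => //; lia).
  by rewrite mulf_eq0 (negPf ne) orbF => /eqP.
have top : ballot (2 * r).-1 (r + r) = 1.
  have -> : (r + r)%N = (2 * r).-1.+1 by lia.
  by rewrite /ballot binn bin_small // subr0.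
case: (ltngtP r 1) => [|r1|r1]; [by lia| |]; last first.
  have := key 1%N r; rewrite r1 => /(_ isT isT erefl).
  by move: top; rewrite r1 => -> /eqP; rewrite -mulr2n (negPf nz2).
(* If the last moments differed, the pairs [(1, r)] and [(2, r - 1)] would prescribe the
   coefficients at [r + 1] and [r + 2]. Their true ratio, read off from [bal], would then give
   [2 (r - 1) (r + 1)^2 = 0]. *)
have k1 : ballot (2 * r).-1 (r + 1) = -1.
  by have := key 1%N r; rewrite top => /(_ ltac:(lia) ltac:(lia) ltac:(lia)) /eqP;
     rewrite addr_eq0 => /eqP.
have k2 : ballot (2 * r).-1 (r + 2) = - (2 * r.-1)%:R.
  have := key 2%N r.-1 ltac:(lia) ltac:(lia) ltac:(lia).
  have -> : ballot (2 * r).-1 (r + r.-1) = (2 * r.-1)%:R.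
    have -> : (r + r.-1)%N = (2 * r).-2.+1 by lia.
    rewrite /ballot (_ : (2 * r).-2.+1 = (2 * r).-1)%N; last by lia.
    rewrite binn (_ : (2 * r).-1 = (2 * r).-2.+1)%N; last by lia.
    by rewrite binSn -natrB; [congr _%:R; lia|lia].
  by move/eqP; rewrite addr_eq0 => /eqP.
have b1 := bal 1%N ltac:(lia); have b2 := bal 2%N ltac:(lia).
have bb : (r + 1)%:R * 'C((2 * r).-1, (r + 2).-1)%:R =
          (r.-1)%:R * 'C((2 * r).-1, (r + 1).-1)%:R :> F.
  rewrite -!natrM; congr _%:R.
  have -> : (r + 2).-1 = (r + 1).-1.+1 by lia.
  rewrite {1}(_ : (r + 1)%N = (r + 1).-1.+1); last by lia.
  by rewrite mul_bin_left; congr (_ * _)%N; lia.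
have : (2 * r.-1)%:R * (r + 1)%:R * (r + 1)%:R = 0 :> F.
  have e1 : (r + 1)%:R * ((r + 2)%:R * - (2 * r.-1)%:R) =
            (r.-1)%:R * ((r + 1)%:R * -1 ) * 2%:R :> F.
    rewrite -k1 -k2 b1 b2 mulrA bb; ring.
  apply/eqP; rewrite -(subr_eq0 _ 0) subr0; apply/eqP.
  move: e1; rewrite !natrM !(natrD _ r) => /eqP; rewrite -subr_eq0 => /eqP e1.
  by rewrite -[RHS]oppr0 -[in RHS]e1; ring.
by apply/eqP; rewrite !mulf_neq0 ?natF ?natrM ?mulf_neq0 ?natF //; lia.
Qed.

End Characteristic.
End RestrictedSumsField.

Lemma subset_of_card (T : finType) (A : {set T}) k :
  k <= #|A| -> exists2 A' : {set T}, A' \subset A & #|A'| = k.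
Proof.
move=> kA; exists [set x in take k (enum A)].
  by apply/subsetP => x; rewrite inE => /mem_take; rewrite mem_enum.
rewrite cardsE (card_uniqP _) ?take_uniq ?enum_uniq //.
by rewrite size_takel // -cardE.
Qed.

(** * The restricted-sum bound in a field of odd prime order *)

Section RestrictedSumsFp.
Import GRing.Theory.
Local Open Scope ring_scope.
Variables (F : finFieldType) (q : nat).
Hypotheses (natF : forall n, (0 < n < q)%N -> n%:R != 0 :> F) (oq : odd q) (cF : #|F| = q).
Implicit Types A B D : {set F}.

Definition contains_restricted_sums A B D :=
  forall a b, a \in A -> b \in B -> a != b -> a + b \in D.

Lemma annihilating_poly A B D N : contains_restricted_sums A B D -> (#|D| <= N)%N ->
  exists P : {poly F}, [/\ size P = N.+1, P \is monic & vanishes_on_restricted_sums A B P].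
Proof.
move=> AB DN; pose G : {poly F} := \prod_(d in D) ('X - d%:P).
have mG : G \is monic by apply: monic_prod => d _; apply: monicXsubC.
have mX : 'X^(N - #|D|) \is @monic F by apply: monicXn.
(* The power of ['X] raises the degree to exactly [N], as the moment arguments require, even when
   [D] is smaller. *)
exists (G * 'X^(N - #|D|)); split.
- rewrite size_Mmonic ?monic_neq0 // size_polyXn /G -big_enum size_prod_XsubC -cardE; lia.
- by rewrite monicMl.
move=> a b aA bB; have [->|ab] := eqVneq a b; first by rewrite subrr mul0r.
rewrite hornerM horner_prod (bigD1 (a + b)) /=; last exact: AB.
by rewrite hornerXsubC subrr !mul0r mulr0.
Qed.

Lemma restricted_sums_Fp_unequal A B D : contains_restricted_sums A B D ->
  (0 < #|A|)%N -> (0 < #|B|)%N -> #|A| <> #|B| -> (#|A| + #|B| <= q + 2)%N ->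
  (#|A| + #|B| <= #|D| + 2)%N.
Proof.
wlog: A B / (#|B| < #|A|)%N => [wl AB A0 B0 nAB sq|BA AB A0 B0 nAB sq].
  case: (ltngtP #|A| #|B|) => [h|h|//]; last exact: wl.
  rewrite addnC; apply: wl => //; try lia.
  by move=> a b aA bB ab; rewrite addrC; apply: AB; rewrite // eq_sym.
rewrite leqNgt; apply/negP => lt.
have [P [sP mP van]] := @annihilating_poly A B D (#|A| + #|B| - 3) AB ltac:(lia).
have cA : (#|A| <= q)%N by rewrite -cF max_card.
by apply: (restricted_sums_unequal natF _ _ _ _ _ sP mP van) => //; lia.
Qed.

Lemma restricted_sums_Fp A B D : contains_restricted_sums A B D ->
  (0 < #|A|)%N -> (0 < #|B|)%N -> (#|D| < q)%N ->
  (#|A| + #|B| <= #|D| + 2 + (A == B))%N.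
Proof.
move=> AB A0 B0 Dq.
have cA : (#|A| <= q)%N by rewrite -cF max_card.
have sub B' : B' \subset B -> contains_restricted_sums A B' D.
  by move=> sB a b aA bB; apply: AB => //; apply: (subsetP sB).
(* Shrinking [B] until the sizes add up to [q + 2], an odd number, makes them different; the unequal
   case then puts [q] elements into [D]. *)
have big : (#|A| + #|B| <= q + 2)%N.
  rewrite leqNgt; apply/negP => lt.
  have [B' sB cB'] := @subset_of_card _ B (q + 2 - #|A|) ltac:(lia).
  have := restricted_sums_Fp_unequal (sub _ sB) A0; rewrite cB'.
  by move=> /(_ ltac:(lia) ltac:(lia) ltac:(lia)); lia.
(* For [A = B], dropping one element of [B] makes the sizes different and costs exactly the allowed
   1. *)
have [eAB|nAB] := eqVneq A B.
  case: (ltnP 1 #|A|) => A1; last by rewrite -eAB; lia.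
  have [B' sB cB'] := @subset_of_card _ B (#|A|.-1) ltac:(rewrite -eAB; lia).
  have := restricted_sums_Fp_unequal (sub _ sB) A0; rewrite cB' -eAB.
  move=> /(_ ltac:(lia) ltac:(lia)); move: big; rewrite -eAB; lia.
case: (eqVneq #|A| #|B|) => [cAB|/eqP cAB]; last first.
  have := restricted_sums_Fp_unequal AB A0 B0 cAB big; lia.
rewrite addn0 leqNgt; apply/negP => lt.
have [P [sP mP van]] := @annihilating_poly A B D (2 * #|A|.-1).-1 AB ltac:(lia).
case/eqP: nAB; apply: (@restricted_sums_equal _ _ natF A B P #|A|.-1) => //; lia.
Qed.
End RestrictedSumsFp.

Local Open Scope group_scope.

(** * Cauchy-Davenport *)

(** A lower bound rather than the least prime divisor itself, so that the condition passes to
    quotients with the same [p]. *)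
Definition prime_divisors_ge (p : nat) (gT : finGroupType) : Prop :=
  forall r, prime r -> r %| #|[set: gT]| -> p <= r.

Section CauchyDavenport.
Variables (gT : finGroupType) (p : nat).
Hypothesis pG : prime_divisors_ge p gT.
Implicit Types A B X : {set gT}.

(** Such an [X] contains a left coset of [<[g]>], and the order of [g] has a prime divisor. *)
Lemma card_rcoset_stable X g : X != set0 -> g != 1 -> X :* g = X -> p <= #|X|.
Proof.
case/set0Pn=> x xX g1 Xg.
have Xgi i : x * g ^+ i \in X.
  elim: i => [|i IH]; first by rewrite expg0 mulg1.
  by rewrite expgSr mulgA -Xg mem_rcoset mulgK.
have sub : x *: <[g]> \subset X.
  by apply/subsetP=> _ /lcosetP[_ /cycleP[i ->] ->].
apply: leq_trans (subset_leq_card sub); rewrite card_lcoset.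
have o1 : 1 < #[g] by rewrite order_gt1.
apply: leq_trans (dvdn_leq (order_gt0 g) (pdiv_dvd #[g])).
apply: pG; first exact: pdiv_prime.
by apply: dvdn_trans (pdiv_dvd _) _; rewrite order_dvdG ?inE.
Qed.

Lemma cauchy_davenport A B :
  A != set0 -> B != set0 -> #|A * B| < p -> #|A| + #|B| <= #|A * B| + 1.
Proof.
(* Lexicographic measure: larger [#|A| + #|B|] first, then smaller [#|A|]. Inversion exchanges the
   factors, so it also decreases the measure when [#|B| < #|A|]. *)
move: {2}_.+1 (ltnSn ((2 * #|gT| - (#|A| + #|B|)) * #|gT|.+1 + #|A|)) => k.
elim: k A B => // k IH A B; rewrite ltnS => Hk A0 B0 ltp.
have cA : #|A| <= #|gT| by exact: max_card.
have cB : #|B| <= #|gT| by exact: max_card.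
case: (ltnP #|B| #|A|) => [ltBA|leAB].
  have E : B^-1 * A^-1 = (A * B)^-1 by rewrite invMg.
  have := IH B^-1 A^-1; rewrite E !card_invg => IH1.
  have inv0 (X : {set gT}) : X != set0 -> X^-1 != set0.
    by rewrite -!cards_eq0 card_invg.
  rewrite addnC; apply: IH1; rewrite ?inv0 // (addnC #|B|).
  by apply: leq_trans Hk; rewrite ltn_add2l.
have [a aA] := set0Pn _ A0.
case: (set_0Vmem (A :\ a)) => [Aa|[b]].
  have -> : A = [set a].
    apply/eqP; rewrite eqEsubset sub1set aA andbT.
    by rewrite -setD_eq0 Aa.
  by rewrite cards1 card_lcoset addnC.
rewrite !inE => /andP[ba bA].
pose g := b^-1 * a.
have g1 : g != 1 by rewrite /g -eq_mulVg1.
have aAg : a \in A :* g by rewrite mem_rcoset /g invMg invgK mulKVg.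
have [Ag|nAg] := eqVneq (A :* g) A.
  have pA := card_rcoset_stable A0 g1 Ag.
  have [c cB'] := set0Pn _ B0.
  have : #|A :* c| <= #|A * B| by apply: subset_leq_card; apply: mulgS; rewrite sub1set.
  by rewrite card_rcoset; clear Hk; lia.
(* DeVos' transforms: neither enlarges the product, and together they preserve
   the total size, so one of them increases [(|A| + |B|, - |A|)]. *)
pose A1 := A :&: A :* g; pose A2 := A :|: A :* g.
pose B1 := B :|: g^-1 *: B; pose B2 := B :&: g^-1 *: B.
have cA12 : #|A2| + #|A1| = #|A| + #|A| by rewrite cardsUI card_rcoset.
have cB12 : #|B1| + #|B2| = #|B| + #|B| by rewrite cardsUI card_lcoset.
have gB x : x \in g^-1 *: B = (g * x \in B) by rewrite mem_lcoset invgK.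
have sub1 : A1 * B1 \subset A * B.
  apply/subsetP=> z /mulsgP[x y]; rewrite !inE gB mem_rcoset => /andP[xA xgA] /orP[] Hy ->.
    by apply: mem_mulg.
  have -> : x * y = (x * g^-1) * (g * y) by rewrite mulgA mulgKV.
  exact: mem_mulg.
have sub2 : A2 * B2 \subset A * B.
  apply/subsetP=> z /mulsgP[x y]; rewrite !inE gB mem_rcoset => /orP[xA|xgA] /andP[Hy Hgy] ->.
    by apply: mem_mulg.
  have -> : x * y = (x * g^-1) * (g * y) by rewrite mulgA mulgKV.
  exact: mem_mulg.
have ltA1 : #|A1| < #|A|.
  rewrite ltn_neqAle subset_leq_card ?subsetIl // andbT.
  apply: contra nAg => /eqP c1; apply/eqP/esym/eqP.
  rewrite eqEcard card_rcoset leqnn andbT.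
  have /eqP E : A1 == A by rewrite eqEcard subsetIl c1 leqnn.
  by rewrite -{1}E subsetIr.
have aA1 : a \in A1 by rewrite inE aA.
have A10 : A1 != set0 by apply/set0Pn; exists a.
have B10 : B1 != set0 by have [c cB'] := set0Pn _ B0; apply/set0Pn; exists c; rewrite inE cB'.
have A20 : A2 != set0 by apply/set0Pn; exists a; rewrite inE aA.
have l1 := subset_leq_card sub1; have l2 := subset_leq_card sub2.
have cA1 : #|A1| <= #|gT| by exact: max_card.
have cB1 : #|B1| <= #|gT| by exact: max_card.
have cA2 : #|A2| <= #|gT| by exact: max_card.
have cB2 : #|B2| <= #|gT| by exact: max_card.
clearbody A1 A2 B1 B2 => {gB sub1 sub2 nAg aAg}.
(* If [B2] is empty, [B1] has [2 * #|B|] elements, which is enough because [#|A| <= #|B|]. *)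
have [B2e|B20] := eqVneq B2 set0.
  move: cB12; rewrite B2e cards0 => cB12.
  have : #|a *: B1| <= #|A1 * B1|.
    by apply: subset_leq_card; apply: mulSg; rewrite sub1set.
  by rewrite card_lcoset; move: cB12 l1 leAB; clear; lia.
case: (leqP (#|A| + #|B|) (#|A1| + #|B1|)) => Hs.
  have := IH A1 B1; move=> /(_ _ A10 B10) IH1.
  suff: #|A1| + #|B1| <= #|A1 * B1| + 1 by move: Hs l1; clear; lia.
  apply: IH1; last by move: l1 ltp; clear; lia.
  apply: leq_trans Hk; rewrite -addnS; apply: leq_add => //.
  by rewrite leq_mul2r leq_sub2l ?orbT.
suff: #|A2| + #|B2| <= #|A2 * B2| + 1.
  by move: Hs l2 cA12 cB12; clear; lia.
apply: IH => //; last by move: l2 ltp; clear; lia.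
apply: leq_trans Hk; apply: leq_trans (leq_addr _ _).
apply: (@leq_trans ((2 * #|gT| - (#|A2| + #|B2|)).+1 * #|gT|.+1)).
  by rewrite (mulSn (2 * #|gT| - _)) (addnC _ #|A2|) ltn_add2r ltnS.
by rewrite leq_mul2r; apply/orP; right; move: Hs cA12 cB12 cA2 cB2; clear; lia.
Qed.
End CauchyDavenport.

(** * Restricted sumsets in groups *)

Lemma restricted_sumsetP (gT : finGroupType) (A B : {set gT}) z :
  reflect (exists a b, [/\ a \in A, b \in B, a != b & z = a * b])
          (z \in restricted_sumset A B).
Proof.
apply: (iffP imset2P) => [[a b aA]|[a [b [aA bB ab ->]]]].
  by rewrite inE => /andP[bB ab] ->; exists a, b.
by exists a b; rewrite // inE bB.
Qed.

Lemma mem_restricted_sumset (gT : finGroupType) (A B : {set gT}) a b :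
  a \in A -> b \in B -> a != b -> a * b \in restricted_sumset A B.
Proof. by move=> aA bB ab; apply/restricted_sumsetP; exists a, b. Qed.

(** By centrality [(x h^i) (x h^j) = x^2 h^(i + j)], so exponents turn restricted products in the
    coset into restricted sums in [F_q]. *)
Lemma restricted_sumset_coset (gT : finGroupType) (H : {group gT}) x (A B : {set gT}) :
  prime #|H| -> odd #|H| -> H \subset 'Z([set: gT]) ->
  A \subset x *: H -> B \subset x *: H -> A != set0 -> B != set0 ->
  #|restricted_sumset A B| < #|H| ->
  #|A| + #|B| <= #|restricted_sumset A B| + 2 + (A == B).
Proof.
move=> pH oH cH sA sB A0 B0 lt.
have /cyclicP[h Hh] := prime_cyclic pH.
have oh : #[h] = #|H| by rewrite orderE -Hh.
set q := #|H| in pH oH lt oh.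
have castq : (Zp_trunc (pdiv q)).+2 = q by apply: Fp_cast.
have hC y : commute (h ^+ y) x.
  have hyH : h ^+ y \in H by rewrite Hh mem_cycle.
  by have /centerP[_] := subsetP cH _ hyH; apply; rewrite inE.
have expF m : h ^+ (m %% (Zp_trunc (pdiv q)).+2) = h ^+ m.
  by rewrite castq -oh expg_mod_order.
pose phi (i : 'F_q) := x * h ^+ i.
have expi (i j : 'F_q) : h ^+ i = h ^+ j -> i = j.
  move/eqP; rewrite eq_expg_mod_order oh => /eqP e; apply: val_inj.
  by move: e; rewrite !modn_small // -[X in _ < X]castq ltn_ord.
have phi_inj : injective phi by move=> i j /mulgI /expi.
have im (X : {set gT}) : X \subset x *: H -> phi @: (phi @^-1: X) = X.
  move=> sX; apply/setP => y; apply/imsetP/idP => [[i]|yX].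
    by rewrite inE => iX ->.
  have /lcosetP[_ /[!Hh] /cycleP[i ->] ey] := subsetP sX y yX.
  exists (i%:R : 'F_q)%R; rewrite ?inE /phi val_Fp_nat // -oh expg_mod_order -ey //.
have imc (X : {set gT}) : X \subset x *: H -> #|phi @^-1: X| = #|X|.
  by move=> sX; rewrite -[in RHS](im X sX) card_imset.
pose C := restricted_sumset A B.
pose psi (i : 'F_q) := x * x * h ^+ i.
have psi_inj : injective psi by move=> i j /mulgI /expi.
pose D := psi @^-1: C.
have cD : #|D| <= #|C|.
  rewrite -(card_imset _ psi_inj); apply: subset_leq_card.
  by apply/subsetP => z /imsetP[i]; rewrite inE => iC ->.
have AB : contains_restricted_sums (phi @^-1: A) (phi @^-1: B) D.
  move=> i j; rewrite !inE => iA jB ij; have := mem_restricted_sumset iA jB.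
  rewrite (inj_eq phi_inj) ij => /(_ isT).
  suff -> : phi i * phi j = psi (i + j)%R by [].
  rewrite /phi /psi /= expF expgD !mulgA; congr (_ * _).
  by rewrite -!mulgA hC.
have natF n : 0 < n < q -> (n%:R != 0 :> 'F_q)%R.
  move=> nq; rewrite -val_eqE /= val_Fp_nat // modn_small //; lia.
have cF : #|{: 'F_q}| = q by rewrite card_Fp.
have := restricted_sums_Fp natF oH cF AB; rewrite !imc // !card_gt0 A0 B0.
move=> /(_ isT isT (leq_ltn_trans cD lt)) le.
apply: leq_trans le _.
have -> : (phi @^-1: A == phi @^-1: B) = (A == B).
  by apply/eqP/eqP => [e|->//]; rewrite -(im A sA) -(im B sB) e.
by rewrite !leq_add2r.
Qed.

Section Inversion.
Variable gT : finGroupType.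
Implicit Types A B : {set gT}.

Lemma invg_set_eq0 A : (A^-1 == set0) = (A == set0).
Proof. by rewrite -!cards_eq0 card_invg. Qed.

Lemma restricted_sumsetV A B :
  restricted_sumset B^-1 A^-1 = (restricted_sumset A B)^-1.
Proof.
apply/setP => z; rewrite mem_invg.
apply/restricted_sumsetP/restricted_sumsetP => [[b [a [bB aA ba ->]]]|[a [b [aA bB ab ez]]]].
  by exists a^-1, b^-1; rewrite -!mem_invg invMg (inj_eq invg_inj) eq_sym.
exists b^-1, a^-1; rewrite !mem_invg !invgK (inj_eq invg_inj) eq_sym.
by rewrite -invMg -ez invgK.
Qed.

Lemma restricted_sumsetS A A' B B' : A \subset A' -> B \subset B' ->
  restricted_sumset A B \subset restricted_sumset A' B'.
Proof.
move=> sA sB; apply/subsetP => z /restricted_sumsetP[a [b [aA bB ab ->]]].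
by apply: mem_restricted_sumset => //; [apply: (subsetP sA)|apply: (subsetP sB)].
Qed.

Lemma restricted_sumset_full A B :
  (forall u, u \in A -> u \in B -> u * u \in restricted_sumset A B) ->
  restricted_sumset A B = A * B.
Proof.
move=> sq; apply/eqP; rewrite eqEsubset; apply/andP; split; apply/subsetP => z.
  by case/restricted_sumsetP=> a [b [aA bB _ ->]]; apply: mem_mulg.
case/mulsgP=> a b aA bB ->; have [ab|ab] := eqVneq a b.
  by rewrite -ab; apply: sq => //; rewrite ab.
exact: mem_restricted_sumset.
Qed.

End Inversion.

(** * Counting a restricted sumset by fibres *)

Section Fibres.
Variables (gT rT : finGroupType) (f : gT -> rT).
Implicit Types (A B X : {set gT}) (x y z : rT).

Definition fibre X x := [set g in X | f g == x].

Lemma fibreP X x g : reflect (g \in X /\ f g = x) (g \in fibre X x).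
Proof. by rewrite inE; apply: (iffP andP) => -[-> /eqP]. Qed.

Lemma mem_fibre X g : g \in X -> g \in fibre X (f g).
Proof. by move=> gX; apply/fibreP. Qed.

Lemma fibre_gt0 X x : (0 < #|fibre X x|) = (x \in f @: X).
Proof.
apply/card_gt0P/imsetP => [[g /fibreP[gX <-]]|[g gX ->]]; first by exists g.
by exists g; apply: mem_fibre.
Qed.

Lemma fibre_neq0 X x : x \in f @: X -> fibre X x != set0.
Proof. by rewrite -fibre_gt0 card_gt0. Qed.

Lemma sum_card_fibre X : \sum_x #|fibre X x| = #|X|.
Proof.
rewrite -sum1_card (partition_big f predT) //=; apply: eq_bigr => x _.
by rewrite -sum1_card; apply: eq_bigl => g; rewrite inE.
Qed.

Lemma sum_card_fibre_im X : \sum_(x in f @: X) #|fibre X x| = #|X|.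
Proof.
rewrite -[RHS]sum_card_fibre [RHS](bigID (mem (f @: X))) /=.
rewrite [X in _ = _ + X]big1 ?addn0 // => x.
by rewrite -fibre_gt0 lt0n negbK => /eqP.
Qed.

Lemma fibre_ext A B : f @: A = f @: B ->
  (forall x, x \in f @: A -> fibre A x = fibre B x) -> A = B.
Proof.
move=> fAB e; apply/setP => g; apply/idP/idP => gX.
  have := mem_fibre gX; rewrite e; last exact: imset_f.
  by case/fibreP.
have := mem_fibre gX; rewrite -e; last by rewrite fAB; apply: imset_f.
by case/fibreP.
Qed.

Section Counting.
Variables (p : nat) (A B : {set gT}).
Hypothesis pG : prime_divisors_ge p gT.
(** Multiplicativity is asked on [A x B] only, so that the count also applies to the map [c |->
    [~ c, g0]] used for singleton fibres. *)
Hypothesis fM : {in A & B, {morph f : a b / a * b}}.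
Let C := restricted_sumset A B.
Hypothesis Cp : #|C| < p.

Lemma fibre_prod x y : x \in f @: A -> y \in f @: B ->
  {in fibre A x & fibre B y, forall a b, a != b} ->
  #|fibre A x| + #|fibre B y| <= #|fibre C (x * y)| + 1.
Proof.
move=> xA yB ab.
have sub : fibre A x * fibre B y \subset fibre C (x * y).
  apply/subsetP => z /mulsgP[a b aX bY ->]; have abn := ab a b aX bY.
  case/fibreP: aX => aA <-; case/fibreP: bY => bB <-.
  by apply/fibreP; rewrite fM //; split=> //; apply: mem_restricted_sumset.
have le := subset_leq_card sub.
apply: leq_trans (_ : #|fibre A x * fibre B y| + 1 <= _); last by rewrite leq_add2r.
apply: (cauchy_davenport pG); try exact: fibre_neq0.
apply: leq_ltn_trans Cp; apply: leq_trans le (subset_leq_card _).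
by apply/subsetP => g /fibreP[].
Qed.

Lemma fibre_offdiag x y : x \in f @: A -> y \in f @: B -> x != y ->
  #|fibre A x| + #|fibre B y| <= #|fibre C (x * y)| + 1.
Proof.
move=> xA yB xy; apply: fibre_prod => // a b /fibreP[_ ea] /fibreP[_ eb].
by apply: contraNneq xy => ab; rewrite -ea -eb ab.
Qed.

Lemma fibre_offdiag_gt0 z :
  z \in restricted_sumset (f @: A) (f @: B) -> 0 < #|fibre C z|.
Proof.
case/restricted_sumsetP=> x [y [xA yB xy ->]].
have := fibre_offdiag xA yB xy; move: xA yB; rewrite -!fibre_gt0.
by move: #|_| #|_| #|_| => u v w; lia.
Qed.

(* Only the fibres over [f @: A :* y] are estimated by their size; any further
   nonempty fibre counts for one. The two sums record by how much the fibres
   exceed these estimates. *)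
Lemma count_translate y (W : {set rT}) d : y \in f @: B ->
  (y \in f @: A -> #|fibre A y| + #|fibre B y| <= #|fibre C (y * y)| + 1 + d) ->
  (forall z, z \in W -> z \notin f @: A :* y -> 0 < #|fibre C z|) ->
  #|A| + #|f @: A| * #|fibre B y| + #|W|
  + (\sum_(x in f @: A | x != y) (#|fibre C (x * y)| + 1 - (#|fibre A x| + #|fibre B y|))
    + \sum_(z in W :\: (f @: A :* y)) (#|fibre C z| - 1))
  <= #|C| + 2 * #|f @: A| + d.
Proof.
move=> yB hd hW; set S := f @: A; set Sy := S :* y.
set e1 := (X in _ + (X + _)); set e2 := (X in _ + (_ + X)).
have cSy : #|Sy| = #|S| by apply: card_rcoset.
have split1 : #|C| = \sum_(z in Sy) #|fibre C z| + \sum_(z | z \notin Sy) #|fibre C z|.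
  by rewrite -[LHS]sum_card_fibre (bigID (mem Sy)).
have eSy : \sum_(z in Sy) #|fibre C z| = \sum_(x in S) #|fibre C (x * y)|.
  by rewrite /Sy -rcosetE /rcoset big_imset //= => u v _ _; apply: mulIg.
have h1 : #|A| + #|S| * #|fibre B y| + e1 <= \sum_(x in S) #|fibre C (x * y)| + #|S| + d.
  rewrite -{1}(sum_card_fibre_im A) -/S -sum_nat_const -big_split /=.
  rewrite -[in X in _ <= X + d]sum1_card -big_split /=.
  have off : \sum_(x in S | x != y) (#|fibre A x| + #|fibre B y|) + e1 =
             \sum_(x in S | x != y) (#|fibre C (x * y)| + 1).
    rewrite /e1 -big_split /=; apply: eq_bigr => x /andP[xS xy].
    by rewrite subnKC //; apply: fibre_offdiag.
  case: (boolP (y \in S)) => yS.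
    rewrite (bigD1 y) //= [X in _ <= X + d](bigD1 y) //= -addnA off.
    by rewrite [X in _ <= X]addnAC leq_add2r hd.
  have eS F : \sum_(x in S) F x = \sum_(x in S | x != y) F x.
    by apply: eq_bigl => x; case: eqP => [->|]; rewrite ?(negPf yS) ?andbT.
  by rewrite [X in X + e1]eS off [in X in _ <= X]eS leq_addr.
have h2 : #|W :\: Sy| + e2 <= \sum_(z | z \notin Sy) #|fibre C z|.
  rewrite -sum1_card /e2 -big_split /=.
  rewrite (eq_bigr (fun z => #|fibre C z|)); last first.
    by move=> z; rewrite inE => /andP[zS zW]; rewrite subnKC // hW.
  rewrite [X in _ <= X](bigID (mem W)) /=; apply: leq_trans (leq_addr _ _).
  by apply/eq_leq/eq_bigl => z; rewrite inE.
have h3 : #|W| <= #|W :\: Sy| + #|S|.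
  by rewrite -cSy -(cardsID Sy W) addnC leq_add2l subset_leq_card // subsetIr.
move: h1 h2 h3; rewrite split1 eSy; set u := \sum_(x in S) _; set v := \sum_(z | _) _.
by clearbody u v e1 e2; clear; lia.
Qed.

Lemma sum_const_le (R : {set rT}) k :
  (forall z, z \in R -> k <= #|fibre C z|) -> #|R| * k <= #|C|.
Proof.
move=> h; rewrite -(sum_card_fibre C) (bigID (mem R)) /=.
by apply: leq_trans (leq_addr _ _); rewrite -sum_nat_const; apply: leq_sum.
Qed.

End Counting.
End Fibres.

(** * Central extensions *)

Definition restricted_bound (p : nat) (gT : finGroupType) : Prop :=
  forall A B : {set gT}, A != set0 -> B != set0 -> #|restricted_sumset A B| < p ->
  #|A| + #|B| <= #|restricted_sumset A B| + 2 + ((A == B) && abelian A).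

Definition small_restricted_sumset (p : nat) (gT : finGroupType) (A B : {set gT}) : Prop :=
  [/\ A != set0, B != set0, #|restricted_sumset A B| < p &
      #|restricted_sumset A B| + 3 <= #|A| + #|B|].

Lemma small_restricted_sumsetV p (gT : finGroupType) (A B : {set gT}) :
  small_restricted_sumset p A B -> small_restricted_sumset p B^-1 A^-1.
Proof.
case=> A0 B0 ltp le; rewrite /small_restricted_sumset !invg_set_eq0 restricted_sumsetV.
by rewrite !card_invg (addnC #|B|).
Qed.

Section CentralExtension.
Variables (gT kT : finGroupType) (f : gT -> kT) (p : nat).
Hypothesis pG : prime_divisors_ge p gT.
Hypothesis pK : prime_divisors_ge p kT.
Hypothesis op : odd p.
Hypothesis fM : {morph f : a b / a * b}.
Hypothesis kerC : forall g h, f g = 1 -> commute g h.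
Hypothesis boundK : restricted_bound p kT.
Hypothesis bound_fibre : forall x (X Y : {set gT}),
  {in X, forall g, f g = x} -> {in Y, forall g, f g = x} -> X != set0 -> Y != set0 ->
  #|restricted_sumset X Y| < p -> #|X| + #|Y| <= #|restricted_sumset X Y| + 2 + (X == Y).
Implicit Types A B : {set gT}.

Let fM_in A B : {in A & B, {morph f : a b / a * b}}.
Proof. by move=> a b _ _; apply: fM. Qed.

Lemma ext_morph1 : f 1 = 1.
Proof. by apply: (mulgI (f 1)); rewrite -fM !mulg1. Qed.

Lemma ext_morphV g : f g^-1 = (f g)^-1.
Proof. by apply: (mulgI (f g)); rewrite -fM !mulgV ext_morph1. Qed.

Lemma imsetV A : f @: A^-1 = (f @: A)^-1.
Proof.
apply/setP => x; rewrite mem_invg; apply/imsetP/imsetP => -[g gA].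
  by move=> ->; exists g^-1; rewrite ?ext_morphV -?mem_invg.
by move=> ex; exists g^-1; rewrite ?mem_invg ?invgK // ext_morphV -ex invgK.
Qed.

Lemma fibreV A x : #|fibre f A^-1 x| = #|fibre f A x^-1|.
Proof.
rewrite -[RHS]card_invg; apply: eq_card => g; rewrite !inE ext_morphV.
by rewrite (inj_eq invg_inj).
Qed.

Lemma fibre_commute g h : f g = f h -> commute g h.
Proof.
move=> e; have k : f (g * h^-1) = 1 by rewrite fM ext_morphV e mulgV.
have := kerC h k; rewrite /commute mulgKV => eg.
by rewrite {1}eg -!mulgA mulVg mulg1.
Qed.

(** * Squares, and images satisfying the sharper bound *)

Section Diagonal.
Variables A B : {set gT}.
Let C := restricted_sumset A B.

Lemma sub_fibre_diag x : restricted_sumset (fibre f A x) (fibre f B x) \subset fibre f C (x * x).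
Proof.
apply/subsetP => z /restricted_sumsetP[a [b [/fibreP[aA <-] /fibreP[bB eb] ab ->]]].
by apply/fibreP; rewrite fM eb; split=> //; apply: mem_restricted_sumset.
Qed.

(** The last bracket is the value of [d] for [count_translate]: at most 2, and 2 only when the two
    fibres coincide. *)
Lemma fibre_diag x : #|C| < p -> x \in f @: A -> x \in f @: B ->
  #|fibre f A x| + #|fibre f B x| <=
  #|fibre f C (x * x)| + 1 + (1 + (fibre f A x == fibre f B x)).
Proof.
move=> ltp xA xB; have le := subset_leq_card (sub_fibre_diag x).
have le2 : #|fibre f C (x * x)| <= #|C|.
  by apply: subset_leq_card; apply/subsetP => g /fibreP[].
have := @bound_fibre x (fibre f A x) (fibre f B x).
have h X : {in fibre f X x, forall g, f g = x} by move=> g /fibreP[].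
move=> /(_ (h A) (h B) (fibre_neq0 xA) (fibre_neq0 xB)).
move: le le2 ltp (fibre f A x == _); clear.
by move: #|fibre f A x| #|fibre f B x| #|fibre f C _| #|C| #|restricted_sumset _ _| => *; lia.
Qed.

Lemma fibre_diag_single x : x \in f @: A -> x \in f @: B -> #|fibre f B x| = 1%N ->
  #|fibre f A x| + #|fibre f B x| <= #|fibre f C (x * x)| + 1 + 1.
Proof.
move=> xA xB b1; have /eqP/cards1P[b eb] := b1; rewrite b1.
have le := subset_leq_card (sub_fibre_diag x).
have sub : (fibre f A x :\ b) :* b \subset restricted_sumset (fibre f A x) (fibre f B x).
  apply/subsetP => z /rcosetP[a]; rewrite in_setD1 => /andP[ab aX] ->.
  by apply: mem_restricted_sumset => //; rewrite eb set11.
have := subset_leq_card sub; rewrite card_rcoset.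
have := cardsD1 b (fibre f A x); move: le; clear.
by move: #|_| #|_| #|_| #|_| (b \in _) => u v w t c; lia.
Qed.

Lemma fibre_diag0 x : x \in f @: A -> x \in f @: B -> #|fibre f C (x * x)| = 0 ->
  fibre f A x = fibre f B x /\ #|fibre f B x| = 1%N.
Proof.
move=> xA xB /eqP; rewrite cards_eq0 => /eqP C0.
have e a b : a \in fibre f A x -> b \in fibre f B x -> a = b.
  move=> aX bX; apply/eqP/negPn/negP => ab.
  have := subsetP (sub_fibre_diag x) _ (mem_restricted_sumset aX bX ab).
  by rewrite C0 inE.
have [a aX] := set0Pn _ (fibre_neq0 xA); have [b bX] := set0Pn _ (fibre_neq0 xB).
have eA : fibre f A x = [set b].
  by apply/setP => g; rewrite in_set1; apply/idP/eqP => [gX|->]; [exact: e|rewrite -(e _ _ aX bX)].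
have eB : fibre f B x = [set b].
  by apply/setP => g; rewrite in_set1; apply/idP/eqP => [gX|->//]; rewrite -(e _ _ aX gX) (e _ _ aX bX).
by rewrite eA eB cards1.
Qed.

Hypothesis smallAB : small_restricted_sumset p A B.
Hypothesis leBA : #|f @: B| <= #|f @: A|.

(** Write [#|B|] as [#|f @: B|] times the largest fibre minus the deficits, and insert
    [#|C| + 3 <= #|A| + #|B|]: the sizes of [A], [B], [C] cancel, leaving only image sizes, deficits
    and excesses. *)
Lemma count_top y (W : {set kT}) d : y \in f @: B ->
  (forall x, x \in f @: B -> #|fibre f B x| <= #|fibre f B y|) ->
  (y \in f @: A -> #|fibre f A y| + #|fibre f B y| <= #|fibre f C (y * y)| + 1 + d) ->
  (forall z, z \in W -> z \notin f @: A :* y -> 0 < #|fibre f C z|) ->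
  (#|f @: A| - #|f @: B|) * (#|fibre f B y| - 1)
  + \sum_(x in f @: B) (#|fibre f B y| - #|fibre f B x|) + #|W| + 3
  + (\sum_(x in f @: A | x != y) (#|fibre f C (x * y)| + 1 - (#|fibre f A x| + #|fibre f B y|))
    + \sum_(z in W :\: (f @: A :* y)) (#|fibre f C z| - 1))
  <= #|f @: A| + #|f @: B| + d.
Proof.
case: smallAB => A0 B0 ltp le yB top hd hW.
set e := (X in _ + X <= _).
have := count_translate pG (@fM_in A B) ltp yB hd hW; rewrite -/C -/e; set s := \sum_(x in f @: B) _.
have eB : (#|B| + s = #|f @: B| * #|fibre f B y|)%N.
  rewrite -(sum_card_fibre_im f B) /s -big_split -sum_nat_const /=.
  by apply: eq_bigr => x xB; rewrite subnKC // top.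
have b0 : 0 < #|fibre f B y| by rewrite fibre_gt0.
move: le eB b0 leBA; rewrite -/C; clearbody e s; clear.
move: #|A| #|B| #|C| #|W| #|f @: A| #|f @: B| #|fibre f B y| => a b c w m n k le eB k0 nm.
have [t ->] : exists t, m = n + t by exists (m - n); rewrite subnKC.
case: k k0 eB => // k _; rewrite addKn subn1 /= !mulnS mulnDl.
by move: (n * k)%N (t * k)%N => u v; lia.
Qed.

Let R := restricted_sumset (f @: A) (f @: B).

(** With [W = R], [count_top] leaves [t + s + 1 <= d <= 2], where [t] measures the difference of the
    image sizes and [s] the deficits of the fibres of [B]. A square of a top element outside [R], or
    [R] being a full product set, gains one more and forces [t + s = 0]. *)
Lemma nearly_uniform_fibres : #|f @: A| + #|f @: B| <= #|R| + 2 ->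
  f @: A = f @: B /\
  ((exists2 b, 2 <= b & {in f @: B, forall y, #|fibre f B y| = b}) \/
   (exists u, [/\ u \in f @: B, #|fibre f A u| = 1%N, #|fibre f B u| = 1%N &
              {in f @: B, forall y, y != u -> #|fibre f B y| = 2}])).
Proof.
move=> leR; have [A0 B0 ltp le] := smallAB.
have [g gB] := set0Pn _ B0.
have [y1 y1B max1] : exists2 y1, y1 \in f @: B &
    forall y, y \in f @: B -> #|fibre f B y| <= #|fibre f B y1|.
  by case: (@arg_maxnP _ (f g) (mem (f @: B)) (fun y => #|fibre f B y|) (imset_f f gB)) => y; exists y.
set b1 := #|fibre f B y1| in max1; set m := #|f @: A| in leR *; set n := #|f @: B| in leR *.
pose s := \sum_(x in f @: B) (b1 - #|fibre f B x|); pose t := ((m - n) * (b1 - 1))%N.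
have star y (W : {set kT}) d : y \in f @: B -> #|fibre f B y| = b1 ->
    (y \in f @: A -> #|fibre f A y| + #|fibre f B y| <= #|fibre f C (y * y)| + 1 + d) ->
    (forall z, z \in W -> z \notin f @: A :* y -> 0 < #|fibre f C z|) ->
    t + s + #|W| + 3 <= m + n + d.
  move=> yB yb hd hW; have := count_top yB _ hd hW; rewrite yb => /(_ max1).
  by apply: leq_trans; rewrite leq_addr.
have RC z : z \in R -> 0 < #|fibre f C z|.
  by move=> zR; apply: (fibre_offdiag_gt0 pG (@fM_in A B) ltp).
have starR y d := fun yB yb hd => star y R d yB yb hd (fun z zR _ => RC z zR).
(* As [y * y] lies in the translate by [y], it may join [W] even if its fibre is empty. *)
have starS y d : y \in f @: A -> y * y \notin R -> y \in f @: B -> #|fibre f B y| = b1 ->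
    (y \in f @: A -> #|fibre f A y| + #|fibre f B y| <= #|fibre f C (y * y)| + 1 + d) ->
    t + s + #|R| + 4 <= m + n + d.
  move=> yA yR yB yb hd; have := star y (y * y |: R) d yB yb hd.
  rewrite cardsU1 yR => h; have := h _; rewrite addnA [t + s + 1 + _]addnAC -addnA; apply.
  move=> z; rewrite in_setU1 => /orP[/eqP->|/RC//].
  by rewrite mem_rcoset mulgK yA.
have topA y : y \in f @: B -> #|fibre f B y| = b1 -> y \in f @: A.
  move=> yB yb; apply/negPn/negP => yA; have := starR y 0 yB yb.
  rewrite (negPf yA) => /(_ ltac:(by [])); move: leR; clear; clearbody t s; lia.
have full : R = f @: A * f @: B -> m + n <= #|R| + 1.
  move=> eR; rewrite eR; apply: (cauchy_davenport pK).
  - by apply/set0Pn; have [a aA] := set0Pn _ A0; exists (f a); apply: imset_f.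
  - by apply/set0Pn; exists (f g); apply: imset_f.
  rewrite -eR; apply: leq_ltn_trans ltp.
  by have := @sum_const_le _ _ f A B R 1 RC; rewrite muln1.
have b1gt0 : 0 < b1 by rewrite /b1 fibre_gt0.
(* With singleton fibres [d = 1] is available. Then no square can be missing from [R], and
   Cauchy-Davenport in [kT] contradicts the count. *)
case: (leqP 2 b1) => b2; last first.
  have allb y : y \in f @: B -> #|fibre f B y| = b1.
    move=> yB; apply/eqP; rewrite eqn_leq max1 //.
    by move: yB; rewrite -fibre_gt0; move: b2; clear; lia.
  have d1 y : y \in f @: B -> (y \in f @: A ->
      #|fibre f A y| + #|fibre f B y| <= #|fibre f C (y * y)| + 1 + 1).
    by move=> yB yA; apply: fibre_diag_single => //; rewrite allb //; move: b2 b1gt0; clear; lia.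
  have eR : R = f @: A * f @: B.
    apply: restricted_sumset_full => u uA uB; apply/negPn/negP => uR.
    have := starS u 1%N uA uR uB (allb _ uB) (d1 _ uB).
    by move: leR; clearbody t s; clear; lia.
  have := full eR; have := starR y1 1%N y1B erefl (d1 _ y1B).
  by clearbody t s; clear; lia.
have d2 y : y \in f @: B -> (y \in f @: A ->
    #|fibre f A y| + #|fibre f B y| <= #|fibre f C (y * y)| + 1 + 2).
  move=> yB yA; apply: leq_trans (fibre_diag ltp yA yB) _.
  by rewrite leq_add2l; case: (_ == _).
have sq u : u \in f @: B -> #|fibre f B u| = b1 -> u * u \notin R -> t + s = 0.
  move=> uB ub uR; have := starS u 2 (topA _ uB ub) uR uB ub (d2 _ uB).
  by move: leR; clearbody t s; clear; lia.
have full0 : R = f @: A * f @: B -> t + s = 0.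
  move=> /full; have := starR y1 2 y1B erefl (d2 _ y1B).
  by clearbody t s; clear; lia.
have ts1 : t + s <= 1.
  have := starR y1 2 y1B erefl (d2 _ y1B).
  by move: leR; clearbody t s; clear; lia.
have [s0|s0] := eqVneq s 0.
  have allb y : y \in f @: B -> #|fibre f B y| = b1.
    move=> yB; apply/eqP; rewrite eqn_leq max1 //=.
    move/eqP: s0; rewrite /s sum_nat_eq0 => /forallP/(_ y)/implyP/(_ yB).
    by rewrite subn_eq0.
  have mn : m <= n.
    rewrite leqNgt; apply/negP => nm.
    have t0 : 0 < t by rewrite /t muln_gt0 !subn_gt0 nm.
    have : t + s = 0; last by move: t0; clear; lia.
    apply: full0; apply: restricted_sumset_full => u uA uB; apply/negPn/negP => uR.
    by have := sq u uB (allb _ uB) uR; move: t0; clear; lia.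
  have eAB : f @: A = f @: B.
    apply/esym/eqP; rewrite eqEcard mn andbT; apply/subsetP => y yB.
    exact: topA (allb _ yB).
  by split=> //; left; exists b1.
have s1 : s = 1%N by move: s0 ts1; clearbody t s; clear; lia.
have t0 : t = 0 by move: s1 ts1; clearbody t s; clear; lia.
(* Since [s = 1], [R] is not the full product set and misses some [u * u]. This [u] carries the one
   deficient fibre, and [u * u] has empty fibre in [C], as otherwise it could enlarge [W]. *)
have [/existsP[u /and3P[uA uB uR]]|/existsPn h] :=
    boolP [exists u, [&& u \in f @: A, u \in f @: B & u * u \notin R]]; last first.
  have : t + s = 0; last by rewrite t0 s1.
  apply: full0; apply: restricted_sumset_full => u uA uB; apply/negPn/negP => uR.
  by case/negP: (h u); apply/and3P.
have ub : #|fibre f B u| != b1.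
  by apply/eqP => ub; have := sq u uB ub uR; rewrite t0 s1.
have ublt : #|fibre f B u| < b1 by rewrite ltn_neqAle ub max1.
have rest y : y \in f @: B -> y != u -> #|fibre f B y| = b1.
  move=> yB yu; apply/eqP; rewrite eqn_leq max1 //=.
  have := s1; rewrite /s (bigD1 u) //= (bigD1 y) /=; last by rewrite yB.
  by move: ublt; clear; clearbody b1; move: (bigop _ _ _) #|fibre f B u| #|fibre f B y| => v w r; lia.
have ub1 : b1 = (#|fibre f B u|).+1.
  have := s1; rewrite /s (bigD1 u) //=.
  by move: ublt; clear; clearbody b1; move: (bigop _ _ _) #|fibre f B u| => v w; lia.
have mn : m <= n.
  rewrite leqNgt; apply/negP => nm.
  by have : 0 < t by [rewrite /t muln_gt0 !subn_gt0 nm]; rewrite t0.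
have eAB : f @: A = f @: B.
  apply/esym/eqP; rewrite eqEcard mn andbT; apply/subsetP => y yB.
  by have [->//|yu] := eqVneq y u; apply: topA (rest _ yB yu).
split=> //; right; exists u.
have Cu0 : #|fibre f C (u * u)| = 0.
  apply/eqP; rewrite -leqn0 leqNgt; apply/negP => Cu.
  have := star y1 (u * u |: R) 2 y1B erefl (d2 _ y1B).
  rewrite cardsU1 uR => h; have : t + s + (1 + #|R|) + 3 <= m + n + 2.
    by apply: h => z; rewrite in_setU1 => /orP[/eqP->//|/RC].
  by rewrite t0 s1; move: leR; clear; lia.
have [eu bu] := fibre_diag0 uA uB Cu0.
split=> //; first by rewrite eu.
by move=> y yB yu; rewrite rest // ub1 bu.
Qed.

End Diagonal.

(** Inversion gives the same description for the fibres of [A], and only matching shapes are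
    compatible. Every fibre over [R] then has at least [a + b - 1], respectively 2, elements, which
    is too many since [#|R| >= 2 * #|f @: A| - 2]. *)
Lemma no_small_over_nonexceptional A B : small_restricted_sumset p A B ->
  #|f @: A| + #|f @: B| <= #|restricted_sumset (f @: A) (f @: B)| + 2 ->
  (f @: A = f @: B -> 2 <= #|f @: A|) -> False.
Proof.
move=> small leR m2; set R := restricted_sumset _ _ in leR.
have leRV : #|f @: B^-1| + #|f @: A^-1| <=
    #|restricted_sumset (f @: B^-1) (f @: A^-1)| + 2.
  by rewrite !imsetV restricted_sumsetV !card_invg addnC.
have smallV := small_restricted_sumsetV small.
case: (leqP #|f @: B| #|f @: A|) => [leBA|ltAB]; last first.
  have [|eAB _] := nearly_uniform_fibres smallV _ leRV.
    by rewrite !imsetV !card_invg ltnW.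
  by move: ltAB; rewrite -card_invg -imsetV -eAB imsetV card_invg ltnn.
have [eAB strB] := nearly_uniform_fibres small leBA leR.
have {}m2 := m2 eAB.
have [|_ strA] := nearly_uniform_fibres smallV _ leRV.
  by rewrite !imsetV !card_invg eAB.
have {}strA : (exists2 a, 2 <= a & {in f @: A, forall y, #|fibre f A y| = a}) \/
    (exists u, [/\ u \in f @: A, #|fibre f A u| = 1%N, #|fibre f B u| = 1%N &
      {in f @: A, forall y, y != u -> #|fibre f A y| = 2}]).
  case: strA => [[a a2 ha]|[u [uA bu au hu]]]; [left; exists a => //|right; exists u^-1].
    by move=> y yA; rewrite -(invgK y) -fibreV ha // imsetV mem_invg invgK.
  rewrite !fibreV in bu au; rewrite bu au -mem_invg -imsetV uA; split=> // y yA yu.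
  rewrite -(invgK y) -fibreV hu //; first by rewrite imsetV mem_invg invgK.
  by rewrite -(inj_eq invg_inj) invgK.
case: small => A0 B0 ltp le.
have off := fibre_offdiag pG (@fM_in A B) ltp.
have sA := sum_card_fibre_im f A; have sB := sum_card_fibre_im f B.
case: strA strB => [[a a2 ha] [[b b2 hb]|[u [uB au bu hu]]]|[u [uA au bu hu]] [[b b2 hb]|[v [vB av bv hv]]]].
- rewrite (eq_bigr (fun=> a)) // sum_nat_const in sA.
  rewrite (eq_bigr (fun=> b)) // sum_nat_const -eAB in sB.
  have : #|R| * (a + b - 1) <= #|restricted_sumset A B|.
    apply: (@sum_const_le _ _ f) => z /restricted_sumsetP[x [y [xA yB xy ->]]].
    by have := off x y xA yB xy; rewrite ha // hb //; move: #|_| => w; clear; lia.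
  move: leR le m2 a2 b2; rewrite -sA -sB -eAB; clear.
  move: #|R| #|restricted_sumset A B| #|f @: A| => r c m; nia.
- by move: a2; rewrite -(ha u) ?au // eAB.
- by move: b2; rewrite -(hb u) ?bu // -eAB.
have evu : v = u.
  by apply/eqP/negPn/negP => vu; have := hu v; rewrite eAB av vB => /(_ isT vu).
rewrite {v}evu in vB av bv hv.
rewrite (bigD1 u) //= (eq_bigr (fun=> 2)) in sA; last by move=> x /andP[xA xu]; apply: hu.
rewrite (bigD1 u) //= (eq_bigr (fun=> 2)) in sB; last by move=> x /andP[xA xu]; apply: hv.
have cD : #|f @: A| = (#|[pred x in f @: A | x != u]|).+1.
  by rewrite (cardD1 u) uA add1n; congr _.+1; apply: eq_card => x; rewrite !inE andbC.
rewrite sum_nat_const in sA; rewrite sum_nat_const -eAB in sB.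
have : #|R| * 2 <= #|restricted_sumset A B|.
  apply: (@sum_const_le _ _ f) => z /restricted_sumsetP[x [y [xA yB xy ->]]].
  have := off x y xA yB xy.
  have a0 : 0 < #|fibre f A x| by rewrite fibre_gt0.
  have b0 : 0 < #|fibre f B y| by rewrite fibre_gt0.
  have [ex|xu] := eqVneq x u; last by rewrite (hu x) //; move: b0; clear; move: #|_| #|_| => *; lia.
  by rewrite (hv y) // -?ex 1?eq_sym //; move: a0; clear; move: #|_| #|_| => *; lia.
move: leR le; rewrite -sA -sB -eAB au bu cD; clear.
by move: #|[pred x in _ | _]| #|R| #|restricted_sumset A B| => *; lia.
Qed.

(** * Equal images: equality in all fibre estimates *)

Section SameImage.
Variables A B : {set gT}.
Let C := restricted_sumset A B.
Let S := f @: A.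
Hypothesis smallAB : small_restricted_sumset p A B.
Hypothesis eAB : f @: A = f @: B.

Let ltp : #|C| < p. Proof. by case: smallAB. Qed.
Let SB : S = f @: B. Proof. exact: eAB. Qed.
Let RC z : z \in restricted_sumset S S -> 0 < #|fibre f C z|.
Proof. by rewrite {2}SB => zR; apply: (fibre_offdiag_gt0 pG (@fM_in A B) ltp). Qed.
Let leRC : #|restricted_sumset S S| <= #|C|.
Proof. by have := @sum_const_le _ _ f A B (restricted_sumset S S) 1 RC; rewrite muln1. Qed.
Let S0 : S != set0.
Proof.
by have [/set0Pn[a aA] _ _ _] := smallAB; apply/set0Pn; exists (f a); apply: imset_f.
Qed.

Lemma card_restricted_square : 2 * #|S| <= #|restricted_sumset S S| + 3.
Proof.
have := boundK S0 S0 (leq_ltn_trans leRC ltp); case: (_ && _); clear; lia.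
Qed.

(** When [D * D] has at least [p] elements, [card_restricted_square] still gives
    [2 * #|D| <= p + 2], and parity improves this to [p + 1]. The group [T] is arbitrary because
    both [kT] and [gT] occur. *)
Lemma card_mul_ge (T : finGroupType) (D : {set T}) : prime_divisors_ge p T ->
  D != set0 -> #|D| <= #|S| -> 2 * #|D| <= #|D * D| + 1.
Proof.
move=> pT D0 DS; case: (ltnP #|D * D| p) => h.
  by have := cauchy_davenport pT D0 D0 h; clear; lia.
have := card_restricted_square; move: leRC ltp DS h op; clear; lia.
Qed.

Let supp := [set z | 0 < #|fibre f C z|].
Let J := [set x in S | x * x \notin supp].

(** Off the diagonal every product has a nonempty fibre, so [S * S] is covered by [supp] and the
    squares of [J]. *)
Lemma card_supp_J : 2 * #|S| <= #|supp| + #|J| + 1.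
Proof.
apply: leq_trans (card_mul_ge pK S0 (leqnn _)) _; rewrite leq_add2r.
apply: (@leq_trans #|supp :|: [set x * x | x in J]|).
  apply: subset_leq_card; apply/subsetP => z /mulsgP[x y xS yS ->].
  rewrite in_setU; have [exy|xy] := eqVneq x y.
    rewrite -exy; case: (boolP (x * x \in supp)) => //= xx.
    by apply/imsetP; exists x; rewrite // inE xS.
  by rewrite inE RC //; apply: mem_restricted_sumset.
rewrite cardsU; apply: leq_trans (leq_subr _ _) _.
by rewrite leq_add2l leq_imset_card.
Qed.

(** Over [J] the fibres of [B] are singletons, each with deficit at least 1 against the largest
    fibre; this makes up for the squares missing from [supp]. [count_top] then leaves a total excess
    of at most [d - 2]: hence [d = 2], which needs equal fibres, and all estimates are
    equalities. *)
Lemma same_image_tight y0 : y0 \in f @: B -> 2 <= #|fibre f B y0| ->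
  [/\ A = B, #|[set y in f @: B | #|fibre f B y| == 1%N]| <= 2 &
   forall y, y \in f @: B -> #|fibre f B y| != 1%N ->
     (forall x, x \in f @: A -> x != y ->
        #|fibre f C (x * y)| + 1 = #|fibre f A x| + #|fibre f B y|) /\
     (forall z, z \notin f @: A :* y -> #|fibre f C z| <= 1)].
Proof.
move=> y0B b0.
have [y1 y1B max1] : exists2 y1, y1 \in f @: B &
    forall y, y \in f @: B -> #|fibre f B y| <= #|fibre f B y1|.
  by case: (@arg_maxnP _ y0 (mem (f @: B)) (fun y => #|fibre f B y|) y0B) => y; exists y.
set b1 := #|fibre f B y1| in max1.
have b1ge : 2 <= b1 := leq_trans b0 (max1 _ y0B).
have Jdiag x : x \in J -> fibre f A x = fibre f B x /\ #|fibre f B x| = 1%N.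
  rewrite !inE => /andP[xS xx]; apply: fibre_diag0; rewrite -/C -?eAB //.
  by move: xx; rewrite -leqNgt leqn0 => /eqP.
pose s' := \sum_(x in S | x \notin J) (b1 - #|fibre f B x|).
have es : \sum_(x in S) (b1 - #|fibre f B x|) = (#|J| * (b1 - 1) + s')%N.
  rewrite (bigID (mem J)) /=; congr (_ + _); rewrite -sum_nat_const.
  have -> : \sum_(x in J) (b1 - 1) = \sum_(x in J) (b1 - #|fibre f B x|).
    by apply: eq_bigr => x /Jdiag[_ ->].
  by apply: eq_bigl => x; rewrite !inE andbA andbb.
have jle : #|J| <= #|J| * (b1 - 1) by rewrite leq_pmulr // subn_gt0.
have sJ := card_supp_J.
have sR : 2 * #|S| <= #|supp| + 3.
  apply: leq_trans card_restricted_square _; rewrite leq_add2r subset_leq_card //.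
  by apply/subsetP => z zR; rewrite inE RC.
have d2 y : y \in f @: B -> (y \in f @: A ->
    #|fibre f A y| + #|fibre f B y| <= #|fibre f C (y * y)| + 1 + 2).
  move=> yB yA; apply: leq_trans (fibre_diag ltp yA yB) _.
  by rewrite leq_add2l; case: (_ == _).
have star y d : y \in f @: B -> #|fibre f B y| = b1 ->
   (y \in f @: A -> #|fibre f A y| + #|fibre f B y| <= #|fibre f C (y * y)| + 1 + d) ->
   #|J| + s' + #|supp| + 3 +
   (\sum_(x in f @: A | x != y) (#|fibre f C (x * y)| + 1 - (#|fibre f A x| + #|fibre f B y|))
    + \sum_(z in supp :\: (f @: A :* y)) (#|fibre f C z| - 1)) <= 2 * #|S| + d.
  move=> yB yb hd; have leBA : #|f @: B| <= #|f @: A| by rewrite eAB.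
  have top x : x \in f @: B -> #|fibre f B x| <= #|fibre f B y| by rewrite yb; apply: max1.
  have hW z : z \in supp -> z \notin f @: A :* y -> 0 < #|fibre f C z| by rewrite inE.
  have := count_top smallAB leBA yB top hd hW.
  rewrite -eAB subnn mul0n add0n yb es -/S -/C.
  set e1 := \sum_(x in S | _) _; set e2 := \sum_(z in _) _.
  move: jle; clear; clearbody e1 e2 s'.
  by move: (#|J| * (b1 - 1))%N #|J| #|supp| #|S| => *; lia.
have s'0 : s' = 0.
  have := star y1 2 y1B erefl (d2 _ y1B); move: sJ; clear.
  by set e := (X in _ + X <= _); clearbody e s'; lia.
have J2 : #|J| <= 2.
  have := star y1 2 y1B erefl (d2 _ y1B); move: sR; clear.
  by set e := (X in _ + X <= _); clearbody e s'; lia.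
have topJ y : y \in f @: B -> y \notin J -> #|fibre f B y| = b1.
  move=> yB yJ; apply/eqP; rewrite eqn_leq max1 //=.
  move/eqP: s'0; rewrite /s' sum_nat_eq0 => /forallP/(_ y)/implyP.
  by rewrite SB yB yJ subn_eq0; apply.
have eAB' : A = B.
  apply: (fibre_ext eAB) => x xA; case: (boolP (x \in J)) => [/Jdiag[]//|xJ].
  have xB : x \in f @: B by rewrite -eAB.
  apply/eqP/negPn/negP => nx.
  have d1 : x \in f @: A ->
      #|fibre f A x| + #|fibre f B x| <= #|fibre f C (x * x)| + 1 + 1.
    by move=> _; have := fibre_diag ltp xA xB; rewrite (negPf nx) addn0.
  have := star x 1%N xB (topJ _ xB xJ) d1.
  by move: sJ; clear; set e := (X in _ + X <= _); clearbody e s'; lia.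
split=> //.
  apply: leq_trans J2; apply: subset_leq_card; apply/subsetP => y.
  rewrite inE => /andP[yB /eqP y1b]; apply/negPn/negP => yJ.
  by move: b1ge; rewrite -(topJ _ yB yJ) y1b.
move=> y yB ny.
have yb : #|fibre f B y| = b1.
  by apply: topJ => //; apply: contra ny => /Jdiag[_ ->].
have := star y 2 yB yb (d2 _ yB).
set e1 := \sum_(x in _ | _) _; set e2 := \sum_(z in _) _ => h.
have e10 : e1 = 0 by move: sJ h; clear; clearbody e1 e2 s'; lia.
have e20 : e2 = 0 by move: sJ h; clear; clearbody e1 e2 s'; lia.
split=> [x xA xy|z zy].
  apply/eqP; rewrite eqn_leq; apply/andP; split.
    move/eqP: e10; rewrite /e1 sum_nat_eq0 => /forallP/(_ x)/implyP.
    by rewrite xA xy subn_eq0; apply.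
  exact: (fibre_offdiag pG (@fM_in A B) ltp).
rewrite leqNgt; apply/negP => zC.
move/eqP: e20; rewrite /e2 sum_nat_eq0 => /forallP/(_ z)/implyP.
rewrite in_setD zy inE (ltnW zC) => /(_ isT).
by rewrite subn_eq0 leqNgt zC.
Qed.

End SameImage.

(** * Noncommuting sets over a commuting image *)

Lemma notabelianP A :
  ~~ abelian A -> exists g h, [/\ g \in A, h \in A & g * h != h * g].
Proof.
case/subsetPn=> g gA; rewrite -sub_cent1 => /subsetPn[h hA] ne.
by exists g, h; split=> //; apply: contra ne => /eqP e; apply/cent1P.
Qed.

Lemma central_quotient g h : f g = f h -> exists2 u, h = g * u & forall v, commute u v.
Proof.
move=> e; exists (g^-1 * h); first by rewrite mulKVg.
by move=> v; apply: kerC; rewrite fM ext_morphV e mulVg.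
Qed.

(** Tightness makes elements of non-singleton fibres commute with all of [A]. A noncommuting pair
    [g], [h] thus occupies the at most two singleton fibres, and [g * h], [h * g] are two elements
    in a fibre of [C] that may hold only one. *)
Lemma no_small_noncommuting_square A : small_restricted_sumset p A A ->
  abelian (f @: A) -> ~~ abelian A ->
  (exists2 y, y \in f @: A & 2 <= #|fibre f A y|) -> False.
Proof.
move=> small abS nabA [w wA bw].
have [_ J2 tight] := same_image_tight small erefl wA bw.
have [_ _ ltp _] := small; set C := restricted_sumset A A in ltp tight.
have comS x y : x \in f @: A -> y \in f @: A -> x * y = y * x.
  by move=> xA yA; apply: (centsP abS).
have top g h : g \in A -> h \in A -> #|fibre f A (f h)| != 1%N -> commute g h.
  move=> gA hA bh; apply/eqP/negPn/negP => ngh.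
  have xy : f g != f h by apply: contra ngh => /eqP /fibre_commute /eqP.
  have [xA yA] : f g \in f @: A /\ f h \in f @: A by split; apply: imset_f.
  have [/(_ _ xA xy) eC _] := tight _ yA bh.
  (* By tightness [Z] fills its fibre of [C], which also contains the products in reverse order. So
     [Z] is stable under the central commutator [k], although it has fewer than [p] elements. *)
  pose Z := fibre f A (f g) * fibre f A (f h).
  have sZ : Z \subset fibre f C (f g * f h).
    apply/subsetP => z /mulsgP[a b /fibreP[aA ea] /fibreP[bA eb] ->].
    apply/fibreP; rewrite fM ea eb; split=> //; apply: mem_restricted_sumset => //.
    by apply: contraNneq xy => ab; rewrite -ea -eb ab.
  have lC : #|fibre f C (f g * f h)| <= #|C|.
    by apply: subset_leq_card; apply/subsetP => z /fibreP[].
  have ltZ : #|Z| < p := leq_ltn_trans (leq_trans (subset_leq_card sZ) lC) ltp.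
  have eZ : Z = fibre f C (f g * f h).
    apply/eqP; rewrite eqEcard sZ /=.
    have := cauchy_davenport pG (fibre_neq0 xA) (fibre_neq0 yA) ltZ.
    by rewrite -eC leq_add2r.
  pose k := (g * h)^-1 * (h * g).
  have fk : f k = 1 by rewrite fM ext_morphV !fM (comS _ _ xA yA) mulVg.
  have k1 : k != 1 by rewrite /k -eq_mulVg1.
  have kC v : commute k v by apply: kerC.
  suff Zk : Z :* k = Z.
    have Z0 : Z != set0.
      apply/set0Pn; exists (g * h); apply: mem_mulg; exact: mem_fibre.
    by have := card_rcoset_stable pG Z0 k1 Zk; rewrite leqNgt ltZ.
  apply/eqP; rewrite eqEcard card_rcoset leqnn andbT.
  apply/subsetP => z /rcosetP[_ /mulsgP[a b /fibreP[aA ea] /fibreP[bA eb] ->] ->].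
  have -> : a * b * k = b * a.
    have [u -> uC] := central_quotient (esym ea); have [v -> vC] := central_quotient (esym eb).
    have -> : g * u * (h * v) = g * h * (u * v).
      by rewrite -!mulgA; congr (_ * _); rewrite !mulgA uC.
    have -> : h * v * (g * u) = h * g * (u * v).
      by rewrite -!mulgA; congr (_ * _); rewrite !mulgA vC -!mulgA vC.
    by rewrite -mulgA -kC mulgA /k mulKVg.
  rewrite eZ; apply/fibreP; rewrite fM ea eb comS //; split=> //.
  by apply: mem_restricted_sumset => //; apply: contraNneq xy => ab; rewrite -ea -eb ab.
have [g [h [gA hA ngh]]] := notabelianP nabA.
have bh : #|fibre f A (f h)| == 1%N.
  by apply/negPn/negP => bh; case/eqP: ngh; apply: top.
have bg : #|fibre f A (f g)| == 1%N.
  by apply/negPn/negP => bg; case/eqP: ngh; apply/esym; apply: top.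
have xy : f g != f h by apply: contra ngh => /eqP /fibre_commute /eqP.
have [xA yA] : f g \in f @: A /\ f h \in f @: A by split; apply: imset_f.
have nbw : #|fibre f A w| != 1%N by move: bw; case: #|_| => [|[|]].
have single s : s \in f @: A -> #|fibre f A s| = 1%N -> s = f g \/ s = f h.
  move=> sA bs; have [->|sg] := eqVneq s (f g); first by left.
  have [->|sh] := eqVneq s (f h); first by right.
  suff : 3 <= #|[set y in f @: A | #|fibre f A y| == 1%N]| by move: J2; clear; lia.
  have <- : #|[set s; f g; f h]| = 3.
    by rewrite -setUA cardsU1 cards2 !inE xy (negPf sg) (negPf sh).
  apply: subset_leq_card; apply/subsetP => z; rewrite !inE.
  by case/orP=> [/orP[]|] /eqP->; rewrite ?sA ?xA ?yA ?bs ?bg ?bh.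
(* If [f g * f h = s * w] with [s] in the image, then [s] and [w] both have large fibres, so [g]
   commutes with lifts [a], [b] of them. As [a * b] is [g * h] times a central element, [g] would
   commute with [h]. *)
have nz : f g * f h \notin f @: A :* w.
  rewrite mem_rcoset; apply/negP; set s := _ * w^-1 => sA.
  have es : f g * f h = s * w by rewrite /s mulgKV.
  have [bs|bs] := eqVneq #|fibre f A s| 1%N.
    case: (single s sA bs) => e; move: es; rewrite e.
      by move/mulgI => e2; move: nbw; rewrite -e2 bh.
    by rewrite comS // => /mulgI => e2; move: nbw; rewrite -e2 bg.
  have /imsetP[a aA ea] := sA; have /imsetP[b bA eb] := wA.
  have ca : commute g a by apply: top => //; rewrite -ea.
  have cb : commute g b by apply: top => //; rewrite -eb.
  have [u eu uC] : exists2 u, a * b = g * h * u & forall v, commute u v.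
    by apply: central_quotient; rewrite !fM -ea -eb es.
  have := commuteM ca cb; rewrite eu => cgu; case/eqP: ngh.
  have : g * (g * h * u) * u^-1 = g * h * u * g * u^-1 by rewrite cgu.
  rewrite -!mulgA (mulgA u g) (uC g) -!mulgA !mulgV !mulg1 !mulgA.
  by rewrite -!mulgA => /mulgI.
have [_ /(_ _ nz)] := tight _ wA nbw; rewrite leqNgt => /negP; apply.
have <- : #|[set g * h; h * g]| = 2 by rewrite cards2 ngh.
apply: subset_leq_card; apply/subsetP => z; rewrite !inE => /orP[] /eqP->.
  rewrite fM eqxx andbT; apply: mem_restricted_sumset => //.
  by apply: contraNneq xy => ->.
rewrite fM comS // eqxx andbT; apply: mem_restricted_sumset => //.
by apply: contraNneq xy => ->.
Qed.

(* If all fibres are singletons and [restricted_sumset A B] is too small, then [B] is the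
   conjugate of [A] by some [g0] in both, and [a |-> [~ a, g0]] is multiplicative
   on [A * B]; counting along this map instead of [f] gives the contradiction. *)
Lemma no_small_singletons A B : small_restricted_sumset p A B ->
  f @: A = f @: B -> abelian (f @: A) ->
  {in f @: A, forall x, #|fibre f A x| = 1%N} ->
  {in f @: B, forall x, #|fibre f B x| = 1%N} ->
  ~~ ((A == B) && abelian A) -> False.
Proof.
move=> small eAB abS a1 b1 nexc.
have [A0 B0 ltp le] := small; set C := restricted_sumset A B in ltp le.
have inj1 (X : {set gT}) : {in f @: X, forall x, #|fibre f X x| = 1%N} -> {in X &, injective f}.
  move=> x1 a b aX bX e; have /eqP/cards1P[c ec] := x1 _ (imset_f f aX).
  have : a \in fibre f X (f a) by apply: mem_fibre.
  have : b \in fibre f X (f a) by rewrite e; apply: mem_fibre.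
  by rewrite ec !inE => /eqP-> /eqP->.
have injA := inj1 A a1; have injB := inj1 B b1.
have cA : #|f @: A| = #|A| by apply: card_in_imset.
have cB : #|f @: B| = #|B| by apply: card_in_imset.
have comS x y : x \in f @: A -> y \in f @: A -> x * y = y * x.
  by move=> xA yA; apply: (centsP abS).
have liftB a : a \in A -> exists2 b, b \in B & f b = f a.
  by move=> aA; have := imset_f f aA; rewrite eAB => /imsetP[b bB ->]; exists b.
have liftA b : b \in B -> exists2 a, a \in A & f a = f b.
  by move=> bB; have := imset_f f bB; rewrite -eAB => /imsetP[a aA ->]; exists a.
have sR : restricted_sumset (f @: A) (f @: A) \subset f @: C.
  apply/subsetP => z /restricted_sumsetP[x [y [/imsetP[a aA ->] /imsetP[a' a'A ->] xy ->]]].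
  have [b bB eb] := liftB _ a'A; rewrite -eb -fM; apply/imset_f/mem_restricted_sumset => //.
  by apply: contraNneq xy => ->; rewrite eb.
have sq := card_restricted_square small eAB.
(* [f @: C] already has at least [2 * #|A| - 3 >= #|C|] elements. *)
have injC : {in C &, injective f}.
  apply/imset_injP; rewrite eqn_leq leq_imset_card /=.
  rewrite -(leq_add2r 3); apply: leq_trans le _.
  rewrite -cB -eAB -cA addnn -mul2n; apply: leq_trans sq _.
  by rewrite leq_add2r subset_leq_card.
have {sq sR} le2 : #|C| + 3 <= 2 * #|A| by move: le; rewrite -cB -eAB cA; clear; lia.
have neAB : A != B.
  apply/eqP => e; move: nexc; rewrite e eqxx /= -e => /notabelianP[g [h [gA hA ngh]]].
  have gh : g != h by apply: contraNneq ngh => ->.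
  case/eqP: ngh; apply: injC; last by rewrite !fM comS ?imset_f.
    by apply: mem_restricted_sumset; rewrite // -e.
  by apply: mem_restricted_sumset; rewrite -?e // eq_sym.
(* For disjoint [A], [B] no product is excluded, and [f @: C] would contain the whole product set of
   the image, which is too large. *)
have [g0 g0A g0B] : exists2 g0, g0 \in A & g0 \in B.
  case: (boolP [exists g, (g \in A) && (g \in B)]) => [/existsP[g /andP[]]|/existsPn no].
    by exists g.
  have sSS : f @: A * f @: A \subset f @: C.
    apply/subsetP => z /mulsgP[x y /imsetP[a aA ->] /imsetP[a' a'A ->] ->].
    have [b bB eb] := liftB _ a'A; rewrite -eb -fM; apply/imset_f/mem_restricted_sumset => //.
    by apply: contraNneq (no a) => ab; rewrite aA ab.
  have S0 : f @: A != set0.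
    by have [a aA] := set0Pn _ A0; apply/set0Pn; exists (f a); apply: imset_f.
  have leC := leq_trans (subset_leq_card sSS) (leq_imset_card f (mem C)).
  have := leq_trans (card_mul_ge small eAB pK S0 (leqnn _)) (leq_add leC (leqnn 1)).
  by rewrite cA; move: le2; clear; move: #|A| #|C| => *; lia.
have conjB a b : a \in A -> b \in B -> f a = f b -> b = a ^ g0.
  move=> aA bB eab; have [e0|n0] := eqVneq (f a) (f g0).
    by rewrite (injA _ _ aA g0A e0) (injB _ _ bB g0B _) -?eab // conjgE mulKg.
  have : a * g0 = g0 * b.
    apply: injC.
    - by apply: mem_restricted_sumset => //; apply: contraNneq n0 => ->.
    - by apply: mem_restricted_sumset => //; apply: contraNneq n0 => e; rewrite eab e.
    by rewrite !fM -eab comS ?imset_f.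
  by rewrite conjgE => ->; rewrite mulKg.
pose th (c : gT) : gT := [~ c, g0].
have thC c v : f c \in f @: A -> commute (th c) v.
  move=> cS; apply: kerC; rewrite /th commgEl conjgE !fM !ext_morphV.
  by rewrite (comS _ _ cS (imset_f f g0A)) mulKg mulVg.
have fBA b : b \in B -> f b \in f @: A by move=> bB; rewrite eAB imset_f.
have thJ c v : f c \in f @: A -> th c ^ v = th c.
  by move=> cS; rewrite conjgE thC // mulKg.
have thM : {in A & B, {morph th : a b / a * b}}.
  by move=> a b aA bB; rewrite /th commMgJ -/(th a) thJ // imset_f.
have thAB a b : a \in A -> b \in B -> f a = f b -> th b = th a.
  move=> aA bB e; rewrite (conjB _ _ aA bB e) -[RHS](@thJ _ g0) ?imset_f // /th.
  by rewrite conjRg (_ : g0 ^ g0 = g0) // conjgE mulKg.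
have th1 a : a \in A -> a \in B -> th a = 1.
  by move=> aA aB; rewrite /th commgEl -(conjB _ _ aA aB) // mulVg.
have th1B a : a \in A -> th a = 1 -> a \in B.
  move=> aA ta; have [b bB eb] := liftB _ aA; rewrite (_ : a = b) //.
  rewrite (conjB _ _ aA bB (esym eb)); apply/eqP.
  by rewrite eq_mulVg1 -commgEl -/(th a) ta.
pose D : {set gT} := th @: A.
have DB : D = th @: B.
  apply/setP => v; apply/imsetP/imsetP => -[c cX ->].
    by have [b bB eb] := liftB _ cX; exists b; rewrite // (thAB c).
  by have [a aA ea] := liftA _ cX; exists a; rewrite // (thAB a).
have D1 : 1 \in D by apply/imsetP; exists g0; rewrite ?th1.
have D0 : D != set0 by apply/set0Pn; exists 1.
have D2 : 2 <= #|D|.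
  rewrite ltnNge; apply/negP => D1'; case/negP: neAB.
  rewrite eqEcard -cA -cB eAB leqnn andbT; apply/subsetP => a aA; apply: th1B => //.
  have /cards1P[v ev] : #|D| == 1%N by rewrite eqn_leq D1' card_gt0.
  have : th a \in D by apply: imset_f.
  by move: D1; rewrite ev !inE => /eqP-> /eqP.
have DD : 2 * #|D| <= #|D * D| + 1.
  by apply: (card_mul_ge small eAB pG D0); rewrite cA; apply: leq_imset_card.
(* A coincidence [a = b] puts the element in both sets, where [th] is trivial; so only the pair
   [(1, 1)] loses products. *)
have prod v w : v \in D -> w \in D -> (v, w) != (1, 1) ->
    #|fibre th A v| + #|fibre th B w| <= #|fibre th C (v * w)| + 1.
  move=> vD wD vw; apply: (fibre_prod pG thM ltp); rewrite -?DB // => a b.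
  case/fibreP=> aA ea /fibreP[bB eb]; apply: contraNneq vw => ab.
  by rewrite -ea -eb -ab th1 // ab.
have pos v w : v \in D -> w \in D -> (v, w) != (1, 1) -> 0 < #|fibre th C (v * w)|.
  move=> vD wD vw; have := prod v w vD wD vw.
  have : 0 < #|fibre th A v| by rewrite fibre_gt0.
  have : 0 < #|fibre th B w| by rewrite fibre_gt0 -DB.
  by clear; move: #|fibre th A v| #|fibre th B w| #|fibre th C _| => *; lia.
have [y1 y1D max1] : exists2 y, y \in D & forall v, v \in D -> #|fibre th B v| <= #|fibre th B y|.
  by case: (@arg_maxnP _ 1 (mem D) (fun y => #|fibre th B y|) D1) => y; exists y.
have sB : #|B| = \sum_(v in D) #|fibre th B v| by rewrite DB sum_card_fibre_im.
have eBA : #|B| = #|A| by rewrite -cB -cA eAB.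
(* A largest fibre away from 1 has [d = 0]. If it occurs only at 1, each other fibre is smaller by
   at least 1, and these [#|D| - 1] deficits pay for [d = 2]. *)
have [[y yD /andP[yn1 /eqP yb]]|none] :
    (exists2 y, y \in D & (y != 1) && (#|fibre th B y| == #|fibre th B y1|)) \/
    (forall y, y \in D -> y != 1 -> #|fibre th B y| < #|fibre th B y1|).
  case: (boolP [exists (y | y \in D), (y != 1) && (#|fibre th B y| == #|fibre th B y1|)]).
    by case/existsP=> y /andP[yD h]; left; exists y.
  move/existsPn => no; right=> y yD yn1; rewrite ltn_neqAle max1 // andbT.
  by have := no y; rewrite yD yn1.
- have h1 : y \in th @: A ->
      #|fibre th A y| + #|fibre th B y| <= #|fibre th C (y * y)| + 1 + 0.
    by move=> _; rewrite addn0 prod // xpair_eqE (negPf yn1).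
  have h2 z : z \in D * D :\ 1 -> z \notin th @: A :* y -> 0 < #|fibre th C z|.
    rewrite in_setD1 => /andP[zn1 /mulsgP[v w vD wD ez]] _; rewrite ez pos //.
    by apply: contraNneq zn1 => -[ev ew]; rewrite ez ev ew mulg1.
  have yB : y \in th @: B by rewrite -DB.
  have := leq_trans (leq_addr _ _) (count_translate pG thM ltp yB h1 h2).
  have : #|B| <= #|D| * #|fibre th B y|.
    by rewrite sB yb -sum_nat_const; apply: leq_sum.
  have := cardsD1 1 (D * D); rewrite -/C -/D eBA.
  move: DD le2; clear; move: (leq_b1 (1 \in D * D)); move: (nat_of_bool (1 \in D * D)) => k.
  set u := #|D * D|; set v := #|(D * D)^#|; set w := (_ * _)%N.
  by clearbody u v w; move: #|D| #|A| #|C| => *; lia.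
have y11 : y1 = 1.
  by apply/eqP/negPn/negP => n1; have := none _ y1D n1; rewrite ltnn.
rewrite {y1}y11 in y1D max1 none.
have eA1 : fibre th A 1 = fibre th B 1.
  apply/setP => g; apply/fibreP/fibreP => -[gX tg]; split=> //; first exact: th1B.
  have [a aA ea] := liftA _ gX; have ta : th a = 1 by rewrite -(thAB _ _ aA gX ea).
  by rewrite -(injB _ _ (th1B _ aA ta) gX ea).
(* The fibre over 1 consists of the common elements of [A] and [B]; [f] embeds it in [kT], where
   [boundK] applies. *)
have diag1 : #|fibre th A 1| + #|fibre th B 1| <= #|fibre th C (1 * 1)| + 1 + 2.
  pose T := f @: fibre th A 1.
  have cT : #|T| = #|fibre th A 1|.
    by apply: card_in_imset => a b /fibreP[aA _] /fibreP[bA _]; apply: injA.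
  have sT : restricted_sumset T T \subset f @: fibre th C (1 * 1).
    apply/subsetP => z /restricted_sumsetP[x [y [/imsetP[a aX ->] /imsetP[b bX ->] xy ->]]].
    rewrite -fM; apply: imset_f; case/fibreP: aX => aA ta; case/fibreP: bX => bA tb.
    have bB := th1B _ bA tb; apply/fibreP; rewrite thM // ta tb; split=> //.
    by apply: mem_restricted_sumset => //; apply: contraNneq xy => ->.
  have lT := leq_trans (subset_leq_card sT) (leq_imset_card f (mem (fibre th C (1 * 1)))).
  have lC : #|fibre th C (1 * 1)| <= #|C|.
    by apply: subset_leq_card; apply/subsetP => z /fibreP[].
  have T0 : T != set0 by rewrite -card_gt0 cT fibre_gt0.
  have := boundK T0 T0 (leq_ltn_trans (leq_trans lT lC) ltp).
  rewrite -eA1 -cT; move: lT; case: (_ && _); clear; move: #|T| #|fibre th C _| #|_| => *; lia.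
have h2 z : z \in D * D -> z \notin th @: A :* 1 -> 0 < #|fibre th C z|.
  case/mulsgP=> v w vD wD ->; rewrite mulg1 => zD; apply: pos => //.
  by apply: contraNneq zD => -[-> ->]; rewrite mulg1.
have oB : 1 \in th @: B by rewrite -DB.
have := leq_trans (leq_addr _ _) (count_translate pG thM ltp oB (fun=> diag1) h2).
have : #|B| + (#|D| - 1) <= #|D| * #|fibre th B 1|.
  rewrite sB (bigD1 1) //= (cardsD1 1 D) D1 mulnDl mul1n -addnA leq_add2l.
  rewrite add1n subn1 /= -sum_nat_const -(sum1_card (mem (D :\ 1))).
  rewrite [X in X + _](eq_bigl (mem (D :\ 1))); last by move=> v; rewrite !inE andbC.
  rewrite -big_split /=; apply: leq_sum => v; rewrite !inE => /andP[vn1 vD].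
  by rewrite addn1 none.
rewrite -/C -/D eBA; move: DD le2 D2; clear.
set u := #|D * D|; set w := (_ * _)%N.
by clearbody u w; move: #|D| #|A| #|C| => *; lia.
Qed.

Lemma central_extension_bound : restricted_bound p gT.
Proof.
have core A B : A != set0 -> B != set0 -> #|restricted_sumset A B| < p ->
    ~~ ((A == B) && abelian A) -> #|A| + #|B| <= #|restricted_sumset A B| + 2.
  move=> A0 B0 ltp nexc; rewrite leqNgt; apply/negP => lt.
  have small : small_restricted_sumset p A B by split=> //; rewrite addn3 -addn2.
  have fA0 : f @: A != set0.
    by have [a aA] := set0Pn _ A0; apply/set0Pn; exists (f a); apply: imset_f.
  have fB0 : f @: B != set0.
    by have [b bB] := set0Pn _ B0; apply/set0Pn; exists (f b); apply: imset_f.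
  have two : f @: A = f @: B -> 2 <= #|f @: A|.
    move=> eAB; rewrite ltnNge; apply/negP => c1.
    have /cards1P[x ex] : #|f @: A| == 1%N by rewrite eqn_leq c1 card_gt0.
    have hA : {in A, forall g, f g = x}.
      by move=> g gA; have := imset_f f gA; rewrite ex inE => /eqP.
    have hB : {in B, forall g, f g = x}.
      by move=> g gB; have := imset_f f gB; rewrite -eAB ex inE => /eqP.
    have := bound_fibre hA hB A0 B0 ltp.
    have [e|_] := eqVneq A B; last by rewrite addn0 leqNgt lt.
    case/negP: nexc; rewrite -e eqxx; apply/centsP => g gA h hA'.
    by apply: fibre_commute; rewrite !hA.
  have ltR : #|restricted_sumset (f @: A) (f @: B)| < p.
    apply: leq_ltn_trans (ltp); rewrite -[X in X <= _]muln1.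
    by apply: (@sum_const_le _ _ f) => z zR; apply: (fibre_offdiag_gt0 pG (@fM_in A B) ltp).
  have leR := boundK fA0 fB0 ltR.
  case: (boolP ((f @: A == f @: B) && abelian (f @: A))) => [/andP[/eqP eAB abS]|ne]; last first.
    by rewrite (negPf ne) addn0 in leR; apply: (no_small_over_nonexceptional small leR).
  have big (X Y : {set gT}) : small_restricted_sumset p X Y -> f @: X = f @: Y ->
      (exists2 y, y \in f @: Y & 2 <= #|fibre f Y y|) -> X = Y.
    by move=> sXY eXY [y yY by2]; have [] := same_image_tight sXY eXY yY by2.
  have dich (X : {set gT}) : (exists2 y, y \in f @: X & 2 <= #|fibre f X y|) \/
      {in f @: X, forall y, #|fibre f X y| = 1%N}.
    case: (boolP [exists (y | y \in f @: X), 2 <= #|fibre f X y|]).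
      by case/existsP=> y /andP[]; left; exists y.
    move/existsPn => no; right => y yX; have := no y; rewrite yX /= -leqNgt => le1.
    by apply/eqP; rewrite eqn_leq le1 fibre_gt0.
  case: (dich B) => [exB|sB].
    have e := big A B small eAB exB; rewrite -e in small exB.
    rewrite e eqxx /= -e in nexc.
    exact: (no_small_noncommuting_square small abS nexc exB).
  case: (dich A) => [[x xA ax2]|sA].
    have e : B^-1 = A^-1.
      apply: big (small_restricted_sumsetV small) _ _; first by rewrite !imsetV eAB.
      by exists x^-1; rewrite ?fibreV ?invgK // imsetV mem_invg invgK.
    have {}e : A = B by rewrite -(invgK A) -e invgK.
    by move: ax2; rewrite e sB // -eAB.
  exact: (no_small_singletons small eAB abS sA sB nexc).
move=> A B A0 B0 ltp.
case: (boolP (_ && _)) => [/andP[/eqP e _]|ne]; last by rewrite addn0; apply: core.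
rewrite -e in ltp *; case: (leqP #|A| 1) => A1; first by move: A1; clear; lia.
(* For a commuting [A = B], deleting one point from one copy gives distinct sets at a cost of 1. *)
have [a aA] := set0Pn _ A0.
have cD : #|A| = (#|A :\ a|).+1 by rewrite (cardsD1 a A) aA.
have sub := subset_leq_card (restricted_sumsetS (subxx A) (subD1set A a)).
have := core A (A :\ a) A0.
rewrite -card_gt0 => /(_ ltac:(by move: A1; rewrite cD)) /(_ (leq_ltn_trans sub ltp)).
have nA : A != A :\ a by apply/eqP => eA; move: aA; rewrite eA !inE eqxx.
rewrite (negPf nA) => /(_ isT).
by move: cD sub; clear; move: #|A| #|A :\ a| #|_| #|_| => *; lia.
Qed.

End CentralExtension.

(** A nontrivial nilpotent group has a nontrivial centre, hence a central subgroup of prime order to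
    divide by; [p > 2] makes this prime odd, as the field argument requires. *)
Lemma nilpotent_restricted_bound p (gT : finGroupType) : odd p -> 2 < p ->
  prime_divisors_ge p gT -> nilpotent [set: gT] -> restricted_bound p gT.
Proof.
move=> op p2; move: {2}_.+1 (ltnSn #|gT|) => k.
elim: k gT => // k IH gT; rewrite ltnS => kG pG nilG.
have [G1|nG1] := eqVneq [set: gT] 1.
  move=> A B _ _ _.
  have le1 (X : {set gT}) : #|X| <= 1 
    by rewrite -(cards1 (1 : gT)) subset_leq_card // -[[set 1]]G1 subsetT.
  by have := le1 A; have := le1 B; clear; move: #|A| #|B| => *; lia.
have nZ1 : 'Z([set: gT]) != 1 by rewrite (center_nil_eq1 nilG).
have Z1 : 1 < #|'Z([set: gT])| by rewrite cardG_gt1.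
have [x xZ ox] := Cauchy (pdiv_prime Z1) (pdiv_dvd _).
pose H := <[x]>%G.
have pH : prime #|H| by rewrite -[#|H|]/#[x] ox pdiv_prime.
have sHZ : H \subset 'Z([set: gT]) by rewrite cycle_subG.
have sHG : H \subset [set: gT] by apply: subsetT.
have qp : p <= #|H| by apply: pG => //; apply: cardSg.
have oH : odd #|H| by case: (even_prime pH) => // e2; move: qp p2; rewrite e2; clear; lia.
have HC h v : h \in H -> commute h v.
  by move=> hH; have /centerP[_] := subsetP sHZ _ hH; apply; rewrite inE.
have nH g : g \in 'N(H).
  by apply: (subsetP (cent_sub H)); apply/centP => h hH; apply/commute_sym/HC.
have eT : [set: coset_of H] = [set: gT] / H.
  apply/setP => xb; rewrite inE; case: (cosetP xb) => g gN ->.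
  by rewrite mem_quotient // inE.
have fM : {morph coset H : a b / a * b} by move=> a b; rewrite morphM.
have f1 g : coset H g = 1 -> g \in H by move=> e; apply: coset_idr.
have pK : prime_divisors_ge p (coset_of H).
  move=> r pr; rewrite eT card_quotient; last by apply/subsetP => g _.
  by move=> rd; apply: pG => //; apply: dvdn_trans rd (dvdn_indexg _ _).
have boundK : restricted_bound p (coset_of H).
  apply: IH => //; last by rewrite eT quotient_nil.
  apply: leq_trans kG; rewrite -cardsT eT -(cardsT gT).
  by apply: ltn_quotient => //; rewrite -cardG_gt1 prime_gt1.
apply: (central_extension_bound pG pK op fM _ boundK).
  by move=> g h /f1; apply: HC.
move=> xb X Y hX hY X0 Y0 lt; have [g gX] := set0Pn _ X0.
have sub (Z : {set gT}) : {in Z, forall h, coset H h = xb} -> Z \subset g *: H.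
  move=> hZ; apply/subsetP => h hZ'; rewrite mem_lcoset; apply: f1.
  by apply: (mulgI (coset H g)); rewrite -fM mulKVg mulg1 (hX g gX) (hZ h hZ').
exact: (restricted_sumset_coset pH oH sHZ (sub _ hX) (sub _ hY) X0 Y0 (leq_trans lt qp)).
Qed.

(** For [a] in [A] outside [B], the translate of [B] by [a] loses nothing; inversion provides the
    symmetric case. *)
Lemma restricted_sumset_ge2 (gT : finGroupType) (A B : {set gT}) :
  A != set0 -> B != set0 -> A != B ->
  minn 2 (#|A| + #|B| - 2) <= #|restricted_sumset A B|.
Proof.
wlog /subsetPn[a aA aB] : A B / ~~ (A \subset B) => [wl A0 B0 AB|A0 B0 AB].
  case: (boolP (A \subset B)) => sAB; last exact: wl.
  have nBA : ~~ (B \subset A) by apply: contra AB => sBA; rewrite eqEsubset sAB.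
  have := wl B^-1 A^-1; rewrite restricted_sumsetV !card_invg addnC; apply.
  - by rewrite invSg.
  - by rewrite invg_set_eq0.
  - by rewrite invg_set_eq0.
  by rewrite (inj_eq invg_inj) eq_sym.
case: (leqP 2 #|B|) => B2.
  apply: leq_trans (geq_minl _ _) _; apply: leq_trans B2 _.
  rewrite -(card_lcoset B a); apply: subset_leq_card; apply/subsetP => z /lcosetP[b bB ->].
  by apply: mem_restricted_sumset => //; apply: contraNneq aB => ->.
have /cards1P[b eB] : #|B| == 1%N by rewrite eqn_leq -ltnS B2 card_gt0.
apply: leq_trans (geq_minr _ _) _; rewrite eB cards1.
have sub : (A :\ b) :* b \subset restricted_sumset A [set b].
  apply/subsetP => z /rcosetP[c]; rewrite in_setD1 => /andP[cb cA] ->.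
  by apply: mem_restricted_sumset; rewrite ?set11.
have := subset_leq_card sub; rewrite card_rcoset; have := cardsD1 b A.
by case: (b \in A); clear; move: #|A :\ b| #|A| #|restricted_sumset _ _| => *; lia.
Qed.

Theorem theorem1p1 (gT : finGroupType) (G : {group gT}) (A B : {set gT}) :
  nilpotent G -> A \subset G -> B \subset G ->
  A != set0 -> B != set0 -> A != B ->
  minn (pdiv #|G|) (#|A| + #|B| - 2) <= #|restricted_sumset A B|.
Proof.
move=> nilG sA sB A0 B0 AB; set p := pdiv #|G|.
(* As [pdiv 1 = 1], the trivial group falls in this branch together with the groups of even
   order. *)
have [p2|p2] := leqP p 2.
  by apply: leq_trans (restricted_sumset_ge2 A0 B0 AB); rewrite leq_min geq_minr (leq_trans (geq_minl _ _)).
have G1 : 1 < #|G| by rewrite ltnNge; apply/negP => G1; move: p2; rewrite /p; move: G1; case: #|G| => [|[|]].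
have op : odd p by case: (even_prime (pdiv_prime G1)) => // e; move: p2; rewrite /p e.
(* The bound is proved for a whole [finGroupType], so the sets are pulled back to [subg_of G]. *)
have im (X : {set gT}) : X \subset G -> sgval @: (@sgval _ G @^-1: X) = X.
  move=> sX; apply/setP => g; apply/imsetP/idP => [[u]|gX]; first by rewrite inE => uX ->.
  by exists (subg G g); rewrite ?inE subgK // (subsetP sX).
have inj : injective (@sgval _ G) by apply: subg_inj.
have cim (X : {set gT}) : X \subset G -> #|@sgval _ G @^-1: X| = #|X|.
  by move=> sX; rewrite -[in RHS](im X sX) card_imset.
set A' := @sgval _ G @^-1: A; set B' := @sgval _ G @^-1: B.
have sC : sgval @: restricted_sumset A' B' \subset restricted_sumset A B.
  apply/subsetP => z /imsetP[_ /restricted_sumsetP[a [b [aA bB ab ->]]] ->].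
  by rewrite !inE in aA bB; apply: mem_restricted_sumset; rewrite // (inj_eq inj).
have le := subset_leq_card sC; rewrite card_imset // in le.
have [pC|pC] := leqP p #|restricted_sumset A B|; first by rewrite geq_min pC.
have ne (X : {set gT}) : X \subset G -> X != set0 -> @sgval _ G @^-1: X != set0.
  by move=> sX; rewrite -!card_gt0 cim.
have pG : prime_divisors_ge p (subg_of G).
  move=> r pr rd; apply: pdiv_min_dvd (prime_gt1 pr) _.
  by rewrite (card_isog (isog_subg G)).
have nil' : nilpotent [set: subg_of G] by rewrite -(isog_nil (isog_subg G)).
have := nilpotent_restricted_bound op p2 pG nil' (ne _ sA A0) (ne _ sB B0) (leq_ltn_trans le pC).
have nAB : A' != B' by apply: contra AB => /eqP e; rewrite -(im A sA) -(im B sB) -/A' e.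
rewrite (negPf nAB) addn0 !cim // => h; rewrite geq_min leq_subLR (addnC 2).
by rewrite (leq_trans h) ?orbT // leq_add2r.
Qed.
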